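(* Let $A$ be a nonnegatively graded connected algebra which is further assumed to be finitely generated in degree one and with a finite number of relations, i.e. $A=T(V)/\langle R\rangle$, where $V$ is a finite dimensional vector space concentrated in degree $1$, and the space of relations $R=\bigoplus_{s\in S}R_s\subseteq T(V)_{\ge2}$, for $S\subseteq\mathbb{N}_{\ge2}$, is a finite dimensional graded vector space. Then the left (resp. right) multi-Koszul complex $K(A)_\bullet$ (resp. $K(A)'_\bullet$) coincides with the left (resp. right) Herscovich–Rey complex $(A\otimes\tilde J_\bullet,\tilde\delta_\bullet)$ (resp. $(\tilde J_\bullet\otimes A,\tilde\delta'_\bullet)$). This in turn implies that $A$ is left (resp. right) multi-Koszul if and only if it is left (resp. right) multi-Koszul in the sense of Herscovich–Rey.
   Context: Notation. $k$ is a field, $\pi:T(V)\to A$ the projection, $V^{(n)}=V^{\otimes n}$ for $n\ge0$ ($V^{(0)}=k$). For subspaces $W_1,\dots,W_m$ of $T(V)$, $W_1\otimes\dots\otimes W_m$ denotes the subspace of $T(V)$ spanned by products $w_1\cdots w_m$; $R^{(i)}=R\otimes\dots\otimes R$ ($i$ factors), $R^{(0)}=k$. $R$ is a space of relations: $R\cap(T(V)_{>0}\otimes R\otimes T(V)+T(V)\otimes R\otimes T(V)_{>0})=0$, where $T(V)_{>0}=\bigoplus_{n\ge1}V^{(n)}$. $R_s=R\cap V^{(s)}$. The spaces $J_i\subseteq T(V)$. $J_0=k$, $J_2=R$, $J_{2i+1}=(V\otimes J_{2i})\cap(J_{2i}\otimes V)$ for $i\ge0$ (so $J_1=V$), and for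 $i\ge1$ $$J_{2(i+1)}=\Big(\sum_{N\ge1}\ \bigcap_{\bar n,\bar m}V^{(m_1)}\otimes J_{2n_1}\otimes\dots\otimes V^{(m_i)}\otimes J_{2n_i}\otimes V^{(m_{i+1})}\Big)\cap R^{(i+1)},$$ where $\bar n=(n_1,\dots,n_i)$ runs over $i$-tuples of nonnegative integers with sum $i$ and $\bar m=(m_1,\dots,m_{i+1})$ over $(i+1)$-tuples of nonnegative integers with sum $N$. Multi-Koszul complexes. $K_{L-R}(A)_i=A\otimes J_i\otimes A$, with $A$-bimodule maps $\delta_i^b:K_{L-R}(A)_i\to K_{L-R}(A)_{i-1}$: if $i=2j+1$ and $\omega=\sum\bar\omega_{(1)}\omega_{(2)}=\sum\omega'_{(1)}\bar\omega'_{(2)}\in J_{2j+1}$ with $\bar\omega_{(1)},\bar\omega'_{(2)}\in V$, $\omega_{(2)},\omega'_{(1)}\in J_{2j}$, then $\delta_i^b(1\otimes\omega\otimes1)=\sum\bar\omega_{(1)}\otimes\omega_{(2)}\otimes1-\sum1\otimes\omega'_{(1)}\otimes\bar\omega'_{(2)}$; if $i=2j\ge2$, then $J_{2j}\subseteq\bigoplus_{N\ge0}\bigcap_{l=0}^N V^{(l)}\otimes J_{2j-1}\otimes V^{(N-l)}$, and writing $\omega=\sum_N\omega^N$ accordingly and $\omega^N=\sum\omega^{N,l}_{(1)}\omega^{N,l}_{(2)}\omega^{N,l}_{(3)}\in V^{(l)}\otimes J_{2j-1}\otimes V^{(N-l)}$ for each $0\le l\le N$, $\delta_i^b(1\otimes\omega\otimes1)=\sum_N\sum_{l=0}^N\sum\pi(\omega^{N,l}_{(1)})\otimes\omega^{N,l}_{(2)}\otimes\pi(\omega^{N,l}_{(3)})$.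 The left complex is $K(A)_\bullet=K_{L-R}(A)_\bullet\otimes_Ak$, so $K(A)_i=A\otimes J_i$; the right one is $K(A)'_\bullet=k\otimes_AK_{L-R}(A)_\bullet$, so $K(A)'_i=J_i\otimes A$; both are augmented to $k$ by the augmentation of $A$. $A$ is left (resp. right) multi-Koszul if the augmented left (resp. right) complex is a resolution of the trivial left (resp. right) module $k$. Herscovich–Rey complexes. For $s\ge2$ let $n_s(2j)=sj$, $n_s(2j+1)=sj+1$ ($j\ge0$). For $s\in S$ and $i\ge2$ let $\tilde J_i^s=\bigcap_{l=0}^{n_s(i)-s}V^{(l)}\otimes R_s\otimes V^{(n_s(i)-s-l)}\subseteq V^{(n_s(i))}$, and $\tilde J_i=\bigoplus_{s\in S}\tilde J_i^s$; $\tilde J_i=\tilde J_i^s=V^{(i)}$ for $i=0,1$. For $i\ge1$ the differential $\tilde\delta_i:A\otimes\tilde J_i\to A\otimes\tilde J_{i-1}$ is the $A$-linear map whose restriction to $A\otimes\tilde J_i^s$ is induced by $a\otimes v_1\cdots v_{n_s(i)}\mapsto a\,v_1\cdots v_d\otimes v_{d+1}\cdots v_{n_s(i)}$, $d=n_s(i)-n_s(i-1)$. The right complex has the right $A$-linear differential $\tilde\delta'_i:\tilde J_i\otimes A\to\tilde J_{i-1}\otimes A$ induced on $\tilde J_i^s\otimes A$ by $v_1\cdots v_{n_s(i)}\otimes a\mapsto(-1)^i\,v_1\cdots v_{n_s(i-1)}\otimes v_{n_s(i-1)+1}\cdots v_{n_s(i)}\,a$. $A$ is left (resp. right) multi-Koszul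 in the sense of Herscovich–Rey if the left (resp. right) complex, augmented to $k$, is a resolution of the trivial left (resp. right) module $k$. *)

(* Defs.v *)
From HB Require Import structures.
From mathcomp Require Import all_boot all_order all_algebra.
From mathcomp Require Import generic_quotient ring_quotient.
From mathcomp Require Import boolp classical_sets functions.
From mathcomp Require Import finmap monalg.

Set Implicit Arguments.
Unset Strict Implicit.
Unset Printing Implicit Defensive.

Import GRing.Theory.

Local Open Scope classical_set_scope.
Local Open Scope ring_scope.

Section Span.
Context {k : fieldType} {M : lmodType k}.

Definition is_subspace (P : set M) : Prop :=
  P 0 /\ forall (a : k) x y, P x -> P y -> P (a *: x + y).

Definition span (X : set M) : set M := smallest is_subspace X.

Lemma sub_span X : X `<=` span X.
Proof. exact: sub_smallest. Qed.

Lemma span_subspace X : is_subspace (span X).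
Proof.
split=> [P [[]]//|a x y Xx Xy P [Psub XP]].
by apply: Psub.2; [apply: Xx|apply: Xy].
Qed.

Lemma span_min X P : is_subspace P -> X `<=` P -> span X `<=` P.
Proof. exact: smallest_sub. Qed.

End Span.

(* The tensor product over k: the free vector space on U * W modulo the
   relations of bilinearity. *)
Section Tensor.
Context {k : fieldType} (U W : lmodType k).

Let F : lmodType k := {malg k[(U * W)%type]}.

Definition bilinearity_relations : set F :=
  [set x | exists (a : k) (u u' : U) (w : W),
     x = << (a *: u + u', w) >> - a *: << (u, w) >> - << (u', w) >>] `|`
  [set x | exists (a : k) (u : U) (w w' : W),
     x = << (u, a *: w + w') >> - a *: << (u, w) >> - << (u, w') >>].

Definition tensor_kernel : {pred F} :=
  fun x => `[< span bilinearity_relations x >].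

Lemma tensor_kernel_zmod_closed : zmod_closed tensor_kernel.
Proof.
have [h0 hD] := span_subspace bilinearity_relations.
split; first exact/asboolP.
move=> x y /asboolP Kx /asboolP Ky; apply/asboolP.
by rewrite addrC -scaleN1r; apply: hD.
Qed.

HB.instance Definition _ :=
  GRing.isZmodClosed.Build F tensor_kernel tensor_kernel_zmod_closed.

Definition tensor : Type := Quotient.quot tensor_kernel.
HB.instance Definition _ := GRing.Zmodule.on tensor.

Definition tensor_proj (x : F) : tensor := \pi_(Quotient.quot tensor_kernel)%qT x.

Definition tensor_scale (a : k) (x : tensor) : tensor :=
  tensor_proj (a *: repr x).

Lemma tensor_projP x y :
  tensor_proj x = tensor_proj y <-> span bilinearity_relations (x - y).
Proof.
split=> [/eqP|h].
  by rewrite -Quotient.idealrBE => /asboolP.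
by apply/eqP; rewrite -Quotient.idealrBE; apply/asboolP.
Qed.

Lemma tensor_reprK (x : tensor) : tensor_proj (repr x) = x.
Proof. exact: reprK. Qed.

Lemma tensor_projD x y : tensor_proj (x + y) = tensor_proj x + tensor_proj y.
Proof. by rewrite /tensor_proj [LHS]pi_addr. Qed.

Lemma tensor_projZ a x : tensor_proj (a *: x) = tensor_scale a (tensor_proj x).
Proof.
apply/tensor_projP; rewrite -scalerBr -[_ *: _]addr0.
have [h0 hD] := span_subspace bilinearity_relations.
by apply: hD => //; apply/tensor_projP; rewrite tensor_reprK.
Qed.

Lemma tensor_scaleA a b x :
  tensor_scale a (tensor_scale b x) = tensor_scale (a * b) x.
Proof. by rewrite -[x]tensor_reprK -!tensor_projZ scalerA. Qed.

Lemma tensor_scale1 x : tensor_scale 1 x = x.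
Proof. by rewrite -[x]tensor_reprK -tensor_projZ scale1r. Qed.

Lemma tensor_scaleDr a x y :
  tensor_scale a (x + y) = tensor_scale a x + tensor_scale a y.
Proof.
rewrite -[x]tensor_reprK -[y]tensor_reprK -tensor_projD -!tensor_projZ.
by rewrite scalerDr tensor_projD.
Qed.

Lemma tensor_scaleDl x a b :
  tensor_scale (a + b) x = tensor_scale a x + tensor_scale b x.
Proof.
by rewrite -[x]tensor_reprK -!tensor_projZ scalerDl tensor_projD.
Qed.

HB.instance Definition _ := GRing.Zmodule_isLmodule.Build k tensor
  tensor_scaleA tensor_scale1 tensor_scaleDr tensor_scaleDl.

Lemma tensor_proj_linear : linear tensor_proj.
Proof. by move=> a x y; rewrite tensor_projD tensor_projZ. Qed.

HB.instance Definition _ :=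
  GRing.isLinear.Build k F tensor *:%R tensor_proj tensor_proj_linear.

Definition tens (u : U) (w : W) : tensor := tensor_proj << (u, w) >>.

Lemma tens_linearl (w : W) : linear (tens^~ w).
Proof.
move=> a u u' /=; rewrite -linearP; apply/tensor_projP.
by rewrite opprD addrA; apply: sub_span; left; exists a, u, u', w.
Qed.

Lemma tens_linearr (u : U) : linear (tens u).
Proof.
move=> a w w' /=; rewrite -linearP; apply/tensor_projP.
by rewrite opprD addrA; apply: sub_span; right; exists a, u, w, w'.
Qed.

Lemma tens_span : span [set tens p.1 p.2 | p in [set: (U * W)%type]] = setT.
Proof.
apply/seteqP; split=> // x _; rewrite -[x]tensor_reprK [repr x]monalgE.
rewrite linear_sum; have [h0 hD] := span_subspace [set tens p.1 p.2 | p in setT].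
apply: (big_rec (span _)) => [|p y _ hy]; first exact: h0.
have -> : << (repr x)@_p *g p >> = (repr x)@_p *: << p >> :> F.
  by apply/malgP => q; rewrite mcoeffZ !mcoeffU mulr_natr.
by rewrite linearZ; apply: hD => //; apply: sub_span; exists p => //; case: p.
Qed.

(* The linear map induced by f; it is only meaningful for bilinear f. *)
Definition tlift (X : lmodType k) (f : U -> W -> X) (x : tensor) : X :=
  \sum_(p <- msupp (repr x)) (repr x)@_p *: f p.1 p.2.

End Tensor.

Notation "u *t w" := (tens u w) (at level 40, left associativity) : ring_scope.

Section TensorLift.
Context {k : fieldType} {U W X : lmodType k} (f : U -> W -> X).
Hypothesis f_linearl : forall w, linear (f^~ w).
Hypothesis f_linearr : forall u, linear (f u).

Let F : lmodType k := {malg k[(U * W)%type]}.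
Let f_free (x : F) : X := \sum_(p <- msupp x) x@_p *: f p.1 p.2.

Let f_freeE (d : {fset U * W}) (x : F) : (msupp x `<=` d)%fset ->
  f_free x = \sum_(p <- d) x@_p *: f p.1 p.2.
Proof.
move=> xd; rewrite /f_free (big_fset_incl _ xd) //= => p _ /mcoeff_outdom ->.
exact: scale0r.
Qed.

Let f_free_linear : linear f_free.
Proof.
move=> a x y.
pose d := (msupp x `|` msupp y `|` msupp (a *: x + y))%fset.
rewrite !(@f_freeE d) /d; first last.
- exact: fsubsetUr.
- by rewrite -fsetUA fsubsetUl.
- by rewrite fsetUAC fsubsetUr.
rewrite scaler_sumr -big_split; apply: eq_bigr => p _ /=.
by rewrite mcoeffD mcoeffZ scalerDl scalerA.
Qed.

HB.instance Definition _ :=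
  GRing.isLinear.Build k F X *:%R f_free f_free_linear.

Let f_freeU p : f_free << p >> = f p.1 p.2.
Proof.
by rewrite (f_freeE (msuppU_le (x := 1))) big_seq_fset1 mcoeffUU scale1r.
Qed.

Let f_free_ker x : span (@bilinearity_relations k U W) x -> f_free x = 0.
Proof.
apply: (@span_min _ _ _ [set x | f_free x = 0]); first split=> /= [|a y z hy hz].
- exact: linear0.
- by rewrite linearP /= hy hz scaler0 addr0.
move=> y /= [[a [u [u' [w ->]]]]|[a [u [w [w' ->]]]]];
  rewrite !linearB linearZ /= !f_freeU /=.
- by rewrite f_linearl addrAC addrK subrr.
- by rewrite f_linearr addrAC addrK subrr.
Qed.

Let tlift_proj x : tlift f (tensor_proj x) = f_free x.
Proof.
apply/eqP; rewrite -subr_eq0 -[tlift _ _]/(f_free _) -linearB; apply/eqP.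
by apply: f_free_ker; apply/tensor_projP; rewrite tensor_reprK.
Qed.

Lemma tlift_linear : linear (tlift f).
Proof.
move=> a x y; rewrite -[x]tensor_reprK -[y]tensor_reprK -linearP.
by rewrite !tlift_proj linearP.
Qed.

Lemma tliftE u w : tlift f (u *t w) = f u w.
Proof. by rewrite tlift_proj f_freeU. Qed.

End TensorLift.

Section TensorAlgebra.
Context {k : fieldType}.

(* T(V) is realised as the free associative algebra on the letters indexing
   the basis [vbasis fullv] of V; [inV] is the inclusion of V as the span of
   the letters. *)
Definition TV (V : vectType k) : lalgType k :=
  {malg k[{fmonom 'I_(\dim {:V})}]}.

Context {V : vectType k}.

Definition inV (v : V) : TV V :=
  \sum_i << coord (vbasis fullv) i v *g fmu i >>.

Lemma inV_linear : linear inV.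
Proof.
move=> a u v; rewrite /inV scaler_sumr -big_split; apply: eq_bigr => i _ /=.
rewrite linearP; apply/malgP => m.
by rewrite mcoeffD mcoeffZ !mcoeffU mulrnDl mulrnAr.
Qed.

(* the coefficient of the empty word *)
Definition counit (x : {malg k[{fmonom 'I_(\dim {:V})}]}) : k :=
  mcoeff (@mone _) x.

(* W_1 (x) W_2 as a subspace of T(V) *)
Definition prodS (W1 W2 : set (TV V)) : set (TV V) :=
  span [set x * y | x in W1 & y in W2].

Local Notation "W1 ** W2" := (prodS W1 W2)
  (at level 40, left associativity).

Definition unitS : set (TV V) := span [set 1].

Definition powS (W : set (TV V)) (n : nat) : set (TV V) :=
  iter n (prodS W) unitS.

Definition sumS (P : set nat) (W : nat -> set (TV V)) : set (TV V) :=
  span (\bigcup_(n in P) W n).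

Definition gen : set (TV V) := range inV.

Definition Vpow (n : nat) : set (TV V) := powS gen n.

Definition Tpos : set (TV V) := sumS [set n | (0 < n)%N] Vpow.

Definition space_of_relations (R : set (TV V)) : Prop :=
  is_subspace R /\
  R `&` [set x + y | x in Tpos ** R ** setT & y in setT ** R ** Tpos]
    = [set 0].

Definition homog (R : set (TV V)) (s : nat) : set (TV V) := R `&` Vpow s.

Section J.
Variable R : set (TV V).

(* V^(m_1) (x) Jev n_1 (x) ... (x) V^(m_i) (x) Jev n_i (x) V^(m_(i+1)) *)
Definition alternating_prod (Jev : nat -> set (TV V)) (i : nat)
    (m : i.+1.-tuple nat) (n : i.-tuple nat) : set (TV V) :=
  foldr (fun mn W => Vpow mn.1 ** (Jev mn.2 ** W)) (Vpow (tnth m ord_max))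
        (zip m n).

Definition J_even_step (Jev : nat -> set (TV V)) (i : nat) : set (TV V) :=
  sumS [set N | (0 < N)%N] (fun N =>
    [set x | forall (n : i.-tuple nat) (m : i.+1.-tuple nat),
       sumn n = i -> sumn m = N -> alternating_prod Jev m n x])
  `&` powS R i.+1.

(* [J_table i n] is J_(2n) for n <= i. *)
Fixpoint J_table (i : nat) : nat -> set (TV V) :=
  match i with
  | 0 => fun=> unitS
  | i'.+1 => fun n =>
      if (n <= i')%N then J_table i' n
      else if i' is 0 then R else J_even_step (J_table i') i'
  end.

Definition J_even (i : nat) : set (TV V) := J_table i i.

Definition J (i : nat) : set (TV V) :=
  if odd i then (gen ** J_even i./2) `&` (J_even i./2 ** gen)
  else J_even i./2.

Lemma J_tableE i n : (n <= i)%N -> J_table i n = J_even n.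
Proof.
elim: i => [|i IHi]; first by case: n.
by rewrite leq_eqVlt => /predU1P[->//|]; rewrite ltnS /= => ni; rewrite ni IHi.
Qed.

Lemma J_0 : J 0 = unitS. Proof. by []. Qed.

Lemma J_2 : J 2 = R. Proof. by []. Qed.

Lemma J_odd i : J i.*2.+1 = (gen ** J i.*2) `&` (J i.*2 ** gen).
Proof. by rewrite /J /= odd_double /= uphalf_double doubleK. Qed.

Lemma eq_J_even_step f g i : (forall n, (n <= i)%N -> f n = g n) ->
  J_even_step f i = J_even_step g i.
Proof.
move=> fg; rewrite /J_even_step; congr (sumS _ _ `&` _); apply/funext => N.
suff E (n : i.-tuple nat) (m : i.+1.-tuple nat) : sumn n = i ->
    alternating_prod f m n = alternating_prod g m n.
  by apply/seteqP; split=> x /= h n m nE mE; have := h n m nE mE; rewrite E.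
move=> nE; rewrite /alternating_prod; move: (tnth m ord_max) => z.
have {nE} ni : {in tval n, forall j, (j <= i)%N}.
  move=> j /perm_to_rem/perm_sumn; rewrite nE => -> /=; exact: leq_addr.
elim: (tval n) (tval m) ni => [|j s IHs] [|l t] //= ni.
rewrite IHs ?fg ?ni ?mem_head // => j' j's.
by apply: ni; rewrite in_cons j's orbT.
Qed.

Lemma J_evenS i : (0 < i)%N -> J i.+1.*2 = J_even_step (fun n => J n.*2) i.
Proof.
have -> : (fun n => J n.*2) = J_even.
  by apply/funext => n; rewrite /J odd_double doubleK.
rewrite /J odd_double doubleK; case: i => // i _.
rewrite -[LHS]/(if (i.+1 < i.+1)%N then _ else _) ltnn.
exact/eq_J_even_step/J_tableE.
Qed.

End J.

Record graded_relations (S : set nat) (R : set (TV V)) : Prop :=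
  GradedRelations {
    rel_space : space_of_relations R;
    rel_finite : exists r : seq (TV V), R = span [set` r];
    rel_degree : S `<=` [set s | (2 <= s)%N];
    rel_graded : R = sumS S (homog R)
  }.

Record is_presentation (R : set (TV V)) (A : algType k)
    (pi : {lrmorphism TV V -> A}) : Prop := IsPresentation {
  pres_surj : forall a, exists x, pi x = a;
  pres_ker : forall x, pi x = 0 <-> (setT ** R ** setT) x
}.

Definition is_augmentation (A : algType k) (pi : {lrmorphism TV V -> A})
    (eps : {lrmorphism A -> k^o}) : Prop :=
  forall v, eps (pi (inV v)) = 0.

(* n_s(2j) = sj and n_s(2j+1) = sj + 1 *)
Definition hr_deg (s i : nat) : nat := (s * i./2 + odd i)%N.

Section HerscovichReySpaces.
Variables (S : set nat) (R : set (TV V)).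

Definition HR_Js (s i : nat) : set (TV V) :=
  if (i < 2)%N then Vpow i else
  [set x | forall l, (l <= hr_deg s i - s)%N ->
     (Vpow l ** homog R s ** Vpow (hr_deg s i - s - l)) x].

Definition HR_J (i : nat) : set (TV V) :=
  if (i < 2)%N then Vpow i else sumS S (HR_Js^~ i).

End HerscovichReySpaces.

(* The subspace of T(V) in which the component omega^N of omega in J_(2j)
   lives. *)
Definition J_cap (R : set (TV V)) (j N : nat) : set (TV V) :=
  [set x | forall l, (l <= N)%N ->
     (Vpow l ** J R j.*2.-1 ** Vpow (N - l)) x].

End TensorAlgebra.

(* All complexes live inside A (x) T(V), T(V) (x) A and A (x) T(V) (x) A: since
   k is a field, A (x) W is the subspace spanned by the a (x) w, w in W, and
   similarly on the other side.  A differential d i, from degree i to degree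
   i.-1, is a function on the ambient space of which only the restriction to
   the i-th term matters. *)
Section Complexes.
Context {k : fieldType} {V : vectType k} {A : algType k}.
Variables (pi : TV V -> A) (eps : A -> k).

Local Notation T := (TV V).
Local Notation AT := (tensor A T).
Local Notation TA := (tensor T A).
Local Notation ATA := (tensor (tensor A T) A).

Definition left_term (W : set T) : set AT :=
  span [set a *t w | a in [set: A] & w in W].

Definition right_term (W : set T) : set TA :=
  span [set w *t a | w in W & a in [set: A]].

Definition bi_term (W : set T) : set ATA :=
  span [set x *t b | x in [set a *t w | a in [set: A] & w in W]
                   & b in [set: A]].

Definition left_act (a : A) : AT -> AT := tlift (fun b w => (a * b) *t w).

Definition right_act (a : A) : TA -> TA := tlift (fun w b => w *t (b * a)).

Definition bi_act (a b : A) : ATA -> ATA :=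
  tlift (fun x c => left_act a x *t (c * b)).

Definition same_complex (M : lmodType k) (K : nat -> set M) (d : nat -> M -> M)
    (K' : nat -> set M) (d' : nat -> M -> M) : Prop :=
  (forall i, K i = K' i) /\ (forall i x, K i.+1 x -> d i.+1 x = d' i.+1 x).

(* exactness of ... -> K 2 -> K 1 -> K 0 -> k -> 0 *)
Definition is_resolution (M : lmodType k) (K : nat -> set M) (d : nat -> M -> M)
    (aug : M -> k) : Prop :=
  [/\ aug @` K 0 = setT,
      d 1 @` K 1 = K 0 `&` [set x | aug x = 0] &
      forall i, d i.+2 @` K i.+2 = K i.+1 `&` [set x | d i.+1 x = 0]].

(* On K 0 = A (x) k (resp. k (x) A) these are the augmentation of A. *)
Definition left_aug : AT -> k := @tlift k A T k^o (fun a w => eps a * counit w).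
Definition right_aug : TA -> k := @tlift k T A k^o (fun w a => eps a * counit w).

Section MultiKoszul.
Variable R : set T.

Definition bimodule_map (d : ATA -> ATA) (K K' : set ATA) : Prop :=
  [/\ forall x, K x -> K' (d x),
      forall (c : k) x y, K x -> K y -> d (c *: x + y) = c *: d x + d y &
      forall a b x, K x -> d (bi_act a b x) = bi_act a b (d x)].

(* Finite sums of products in T(V) are given by the lists of their factors. *)
Definition odd_formula (j : nat) (d : ATA -> ATA) : Prop :=
  forall (w : T) (s s' : seq (T * T)),
    J R j.*2.+1 w ->
    (forall p, p \in s -> gen p.1 /\ J R j.*2 p.2) ->
    w = \sum_(p <- s) p.1 * p.2 ->
    (forall p, p \in s' -> J R j.*2 p.1 /\ gen p.2) ->
    w = \sum_(p <- s') p.1 * p.2 ->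
    d (1 *t w *t 1) =
      \sum_(p <- s) pi p.1 *t p.2 *t 1 - \sum_(p <- s') 1 *t p.1 *t pi p.2.

Definition even_formula (j : nat) (d : ATA -> ATA) : Prop :=
  forall (w : T) (n : nat) (wN : nat -> T) (s : nat -> nat -> seq (T * T * T)),
    J R j.*2 w ->
    w = \sum_(N < n) wN N ->
    (forall N, (N < n)%N -> J_cap R j N (wN N)) ->
    (forall N l, (N < n)%N -> (l <= N)%N ->
       (forall p, p \in s N l ->
          [/\ Vpow l p.1.1, J R j.*2.-1 p.1.2 & Vpow (N - l) p.2]) /\
       wN N = \sum_(p <- s N l) p.1.1 * p.1.2 * p.2) ->
    d (1 *t w *t 1) =
      \sum_(N < n) \sum_(l < N.+1) \sum_(p <- s N l)
        pi p.1.1 *t p.1.2 *t pi p.2.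

Definition is_bi_diff (i : nat) (d : ATA -> ATA) : Prop :=
  bimodule_map d (bi_term (J R i)) (bi_term (J R i.-1)) /\
  (if odd i then odd_formula i./2 d else even_formula i./2 d).

(* The bimodule map described by [is_bi_diff]; as the decompositions in the
   two formulas exist, it is unique on the i-th term. *)
Definition bi_diff (i : nat) : ATA -> ATA :=
  xget (fun=> 0) [set d | is_bi_diff i d].

(* The identification (A (x) W (x) A) (x)_A k = A (x) W is induced by
   [bi_to_left], a section of which is x |-> x (x) 1; similarly on the right. *)
Definition bi_to_left : ATA -> AT := tlift (fun x b => eps b *: x).

Definition bi_to_right : ATA -> TA :=
  tlift (fun x b => tlift (fun a w => eps a *: (w *t b)) x).

Definition right_to_bi : TA -> ATA := tlift (fun w b => 1 *t w *t b).

Definition Kleft (i : nat) : set AT := left_term (J R i).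
Definition Kleft_diff (i : nat) (x : AT) : AT :=
  bi_to_left (bi_diff i (x *t 1)).

Definition Kright (i : nat) : set TA := right_term (J R i).
Definition Kright_diff (i : nat) (x : TA) : TA :=
  bi_to_right (bi_diff i (right_to_bi x)).

Definition left_multi_Koszul : Prop := is_resolution Kleft Kleft_diff left_aug.
Definition right_multi_Koszul : Prop :=
  is_resolution Kright Kright_diff right_aug.

End MultiKoszul.

Section HerscovichRey.
Variables (S : set nat) (R : set T).

Definition HRleft (i : nat) : set AT := left_term (HR_J S R i).
Definition HRright (i : nat) : set TA := right_term (HR_J S R i).

Definition prodV (v : seq V) : T := \prod_(u <- v) inV u.

Definition left_module_map (d : AT -> AT) (K K' : set AT) : Prop :=
  [/\ forall x, K x -> K' (d x),
      forall (c : k) x y, K x -> K y -> d (c *: x + y) = c *: d x + d y &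
      forall a x, K x -> d (left_act a x) = left_act a (d x)].

Definition right_module_map (d : TA -> TA) (K K' : set TA) : Prop :=
  [/\ forall x, K x -> K' (d x),
      forall (c : k) x y, K x -> K y -> d (c *: x + y) = c *: d x + d y &
      forall a x, K x -> d (right_act a x) = right_act a (d x)].

(* For i = 1 the summand V does not depend on s, and neither do n_s(1) = 1 and
   n_s(0) = 0; the formula is imposed even if S is empty. *)
Definition is_HRleft_diff (i : nat) (d : AT -> AT) : Prop :=
  left_module_map d (HRleft i) (HRleft i.-1) /\
  forall (s : nat) (r : seq (A * (hr_deg s i).-tuple V)),
    S s \/ i = 1%N ->
    let m := (hr_deg s i - hr_deg s i.-1)%N in
    let x := \sum_(p <- r) p.1 *t prodV p.2 in
    left_term (HR_Js R s i) x ->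
    d x = \sum_(p <- r) (p.1 * pi (prodV (take m p.2))) *t prodV (drop m p.2).

Definition is_HRright_diff (i : nat) (d : TA -> TA) : Prop :=
  right_module_map d (HRright i) (HRright i.-1) /\
  forall (s : nat) (r : seq ((hr_deg s i).-tuple V * A)),
    S s \/ i = 1%N ->
    let m := hr_deg s i.-1 in
    let x := \sum_(p <- r) prodV p.1 *t p.2 in
    right_term (HR_Js R s i) x ->
    d x = (-1) ^+ i *:
      \sum_(p <- r) prodV (take m p.1) *t (pi (prodV (drop m p.1)) * p.2).

Definition HRleft_diff (i : nat) : AT -> AT :=
  xget (fun=> 0) [set d | is_HRleft_diff i d].
Definition HRright_diff (i : nat) : TA -> TA :=
  xget (fun=> 0) [set d | is_HRright_diff i d].

Definition left_multi_Koszul_HR : Prop :=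
  is_resolution HRleft HRleft_diff left_aug.
Definition right_multi_Koszul_HR : Prop :=
  is_resolution HRright HRright_diff right_aug.

End HerscovichRey.
End Complexes.

(* Main.v *)
From mathcomp Require Import all_boot all_order all_algebra.
From mathcomp Require Import boolp classical_sets.
From mathcomp Require Import finmap monalg.
From mathcomp Require Import zify.
Require Import Defs.

(** Let E(s,n) be the space of the elements of T(V) of length n all of whose
    subwords of length s are relations ([chainR]).  For i >= 2 the summand of
    index s of the Herscovich-Rey space of degree i is E(s, n_s(i)).  The theorem
    holds because the intersections that define J_i cannot mix relations of
    different lengths.

    An element lies in V^(l) W V^(r) if and only if it has no words shorter than
    l + r and stripping any word of length l on the left and any word of length
    r on the right leads into W ([sandwichP]).  Hence intersections of such
    spaces are computed by stripping words: for W = E(s,m) with m >= s, in all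
    positions in length n, one obtains E(s,n) ([sandwich_HR_J]).  Moreover
    E(s,m+n) is contained in E(s,m) E(s,n), since tensor products over a field
    commute with intersections ([mulS_cap]); so E(s, s i) is contained in all the
    products that occur in the definition of J_(2i).

    For the equality of J_i with the space of Herscovich and Rey ([J_HR_J])
    induction settles everything but one inclusion.  Let x be an element of
    J_(2(i+1)).  By induction the component of x of length n is a sum of elements
    x_s of E(s,n), where s i + N = n.  As R meets R T_(>0) only in 0, the right
    ideals R_s T are independent ([Rs_independent]).  Since x is in R^(i+1), each
    x_s is therefore in R_s R^(i), and stripping s letters at a time shows,
    as R meets T_(>0) R T only in 0, that x_s = 0 unless n = s (i+1), that is,
    N = s ([chainR_powR_degree]).

    The same independence shows that the components of an element w of J_(2j) in
    the formula for the differential are its homogeneous parts: N belongs to the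
    length (N+1) j ([J_cap_unique]).  So the differential of the bimodule complex
    is induced by a linear map that cuts words at places depending only on their
    lengths ([diff_gen], [bi_diff_eq]).  The augmentation kills all words of
    positive length.  After tensoring with k on one side the only cut that
    survives is the one with all outer letters on the other side, and this is the
    differential of Herscovich and Rey ([left_gen], [right_gen]).

    The algebra of words behind this is developed for any algebra that has a
    basis of words, [free_words]. *)

Set Implicit Arguments.
Unset Strict Implicit.
Unset Printing Implicit Defensive.

Import GRing.Theory.

Local Open Scope classical_set_scope.
Local Open Scope ring_scope.

(** * Subspaces and linear maps *)

Section Subspaces.
Context {k : fieldType} {M : lmodType k}.
Implicit Types P Q : set M.

Lemma subspace0 P : is_subspace P -> P 0.
Proof. by case. Qed.

Lemma subspaceD P : is_subspace P -> forall x y, P x -> P y -> P (x + y).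
Proof. by move=> [_ hP] x y Px Py; rewrite -[x]scale1r; apply: hP. Qed.

Lemma subspaceZ P : is_subspace P -> forall a x, P x -> P (a *: x).
Proof. by move=> [P0 hP] a x Px; rewrite -[a *: x]addr0; apply: hP. Qed.

Lemma subspaceB P : is_subspace P -> forall x y, P x -> P y -> P (x - y).
Proof.
by move=> hP x y Px Py; apply: subspaceD => //; rewrite -scaleN1r; apply: subspaceZ.
Qed.

Lemma subspace_sum P (J : Type) (r : seq J) (C : pred J) (F : J -> M) :
  is_subspace P -> (forall j, C j -> P (F j)) -> P (\sum_(j <- r | C j) F j).
Proof.
move=> hP hF; apply: (big_ind P) => //; first exact: subspace0.
exact: subspaceD.
Qed.

Lemma subspaceI P Q : is_subspace P -> is_subspace Q -> is_subspace (P `&` Q).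
Proof.
move=> [P0 hP] [Q0 hQ]; split=> // a x y [Px Qx] [Py Qy].
by split; [apply: hP|apply: hQ].
Qed.

Section LinearPred.
Context {X : lmodType k} (f : M -> X).
Hypothesis f_lin : linear f.

Lemma lin0 : f 0 = 0.
Proof.
have := f_lin 1 0 0; rewrite !scale1r addr0 => /eqP.
by rewrite -subr_eq0 opprD addNKr oppr_eq0 => /eqP.
Qed.

Lemma linD x y : f (x + y) = f x + f y.
Proof. by rewrite -[x in LHS]scale1r f_lin scale1r. Qed.

Lemma linZ a x : f (a *: x) = a *: f x.
Proof. by rewrite -[_ *: x]addr0 f_lin lin0 addr0. Qed.

Lemma linN x : f (- x) = - f x.
Proof. by rewrite -scaleN1r linZ scaleN1r. Qed.

Lemma linB x y : f (x - y) = f x - f y.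
Proof. by rewrite linD linN. Qed.

Lemma lin_sum (J : Type) (r : seq J) (C : pred J) (F : J -> M) :
  f (\sum_(j <- r | C j) F j) = \sum_(j <- r | C j) f (F j).
Proof. by apply: big_morph; [exact: linD | exact: lin0]. Qed.

Lemma subspace_preim (Z : set X) : is_subspace Z -> is_subspace [set x | Z (f x)].
Proof.
move=> [Z0 hZ]; split=> /= [|a x y Zx Zy]; first by rewrite lin0.
by rewrite f_lin; apply: hZ.
Qed.

End LinearPred.

Lemma subspace_eq {X : lmodType k} (f g : M -> X) :
  linear f -> linear g -> is_subspace [set x | f x = g x].
Proof.
move=> hf hg; split=> /= [|a x y fx fy]; first by rewrite !lin0.
by rewrite hf hg fx fy.
Qed.

End Subspaces.

(** * Free algebras as algebras with a basis of words *)

(** Freeness of T on the letters I, expressed by a basis: [fw_coef] gives the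
    coordinates, [fw_lift] the linear map with prescribed values on words. *)
Record free_words (k : fieldType) (I : finType) (T : lalgType k) := FreeWords {
  fw_word : seq I -> T;
  fw_coef : T -> seq I -> k;
  fw_lift : forall X : lmodType k, (seq I -> X) -> T -> X;
  fw_coef_linear : forall s, linear ((fw_coef^~ s) : T -> k^o);
  fw_coef_word : forall s t, fw_coef (fw_word s) t = (s == t)%:R;
  fw_coef_inj : forall x y, fw_coef x =1 fw_coef y -> x = y;
  fw_coef_finite : forall x, exists n, forall s, (n <= size s)%N -> fw_coef x s = 0;
  fw_word_span : span (range fw_word) = setT;
  fw_word_nil : fw_word [::] = 1;
  fw_word_cat : {morph fw_word : s t / s ++ t >-> s * t};
  fw_scaler_mulr : forall (a : k) (x y : T), x * (a *: y) = a *: (x * y);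
  fw_lift_linear : forall X g, linear (@fw_lift X g);
  fw_lift_word : forall X g s, @fw_lift X g (fw_word s) = g s
}.

Section Words.
Context {k : fieldType} {I : finType} {T : lalgType k} (F : free_words I T).
Implicit Types (x y z : T) (s t u v : seq I) (A B C P W : set T).
Local Notation wd := (fw_word F).
Local Notation cf := (fw_coef F).
Local Notation ext := (fw_lift F).

Definition cf_linear s : linear ((cf^~ s) : T -> k^o) := fw_coef_linear F s.

Lemma cfD x y s : cf (x + y) s = cf x s + cf y s.
Proof. exact: (linD (cf_linear s)). Qed.

Lemma cfB x y s : cf (x - y) s = cf x s - cf y s.
Proof. exact: (linB (cf_linear s)). Qed.

Lemma cfZ a x s : cf (a *: x) s = a * cf x s.
Proof. exact: (linZ (cf_linear s)). Qed.

Lemma cf0 s : cf 0 s = 0.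
Proof. exact: (lin0 (cf_linear s)). Qed.

Lemma cf_sum (J : Type) (r : seq J) (C : pred J) (f : J -> T) s :
  cf (\sum_(j <- r | C j) f j) s = \sum_(j <- r | C j) cf (f j) s.
Proof. exact: (lin_sum (cf_linear s)). Qed.

Lemma wd_ind P : is_subspace P -> (forall s, P (wd s)) -> forall x, P x.
Proof.
move=> hP Pw x; have : span (range wd) x by rewrite fw_word_span.
by apply: (span_min hP) => _ [s _ <-].
Qed.

Lemma wd_ext (X : lmodType k) (f g : T -> X) : linear f -> linear g ->
  (forall s, f (wd s) = g (wd s)) -> f =1 g.
Proof. by move=> hf hg h; apply: wd_ind => //; apply: subspace_eq. Qed.

Lemma mulT_linearl y : linear (fun x : T => x * y).
Proof. by move=> c x x'; rewrite mulrDl scalerAl. Qed.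

Lemma mulT_linearr x : linear (fun y : T => x * y).
Proof. by move=> c y y'; rewrite mulrDr (fw_scaler_mulr F). Qed.

Lemma wd_ext2 (X : lmodType k) (f g : T -> T -> X) :
  (forall y, linear (f^~ y)) -> (forall x, linear (f x)) ->
  (forall y, linear (g^~ y)) -> (forall x, linear (g x)) ->
  (forall s t, f (wd s) (wd t) = g (wd s) (wd t)) -> forall x y, f x y = g x y.
Proof.
move=> fl fr gl gr h x y; move: x; apply: wd_ext => // s.
by move: y; apply: wd_ext.
Qed.

(** A coordinate of a linear extension may be computed on words. *)
Lemma cf_ext_eq (g : seq I -> T) (c : T -> seq I -> k) :
  (forall t, linear ((c^~ t) : T -> k^o)) ->
  (forall s t, cf (g s) t = c (wd s) t) -> forall x t, cf (ext g x) t = c x t.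
Proof.
move=> cl h x t; move: x.
apply: (@wd_ext k^o (fun x => cf (ext g x) t)) => // [a x y|s].
  by rewrite (fw_lift_linear F) cf_linear.
by rewrite (fw_lift_word F).
Qed.

Lemma cf_mul x y s :
  cf (x * y) s = \sum_(i < (size s).+1) cf x (take i s) * cf y (drop i s).
Proof.
move: x y.
apply: (@wd_ext2 k^o (fun x y => cf (x * y) s)
  (fun x y => \sum_(i < (size s).+1) cf x (take i s) * cf y (drop i s))).
- by move=> y a x x'; rewrite mulT_linearl cf_linear.
- by move=> x a y y'; rewrite mulT_linearr cf_linear.
- move=> y a x x'; rewrite scaler_sumr -big_split; apply: eq_bigr => i _ /=.
  by rewrite cfD cfZ mulrDl [in RHS]/GRing.scale /= mulrA.
- move=> x a y y'; rewrite scaler_sumr -big_split; apply: eq_bigr => i _ /=.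
  by rewrite cfD cfZ mulrDr [in RHS]/GRing.scale /= mulrCA.
move=> u v; rewrite -(fw_word_cat F) (fw_coef_word F).
have [<-|neq] := eqVneq.
  have lt : (size u < (size (u ++ v)).+1)%N by rewrite ltnS size_cat leq_addr.
  rewrite (bigD1 (Ordinal lt)) //= take_size_cat // drop_size_cat // !(fw_coef_word F).
  rewrite !eqxx mulr1 big1 ?addr0 // => i /eqP ne; rewrite !(fw_coef_word F).
  case: eqP => [E|]; last by rewrite mul0r.
  have := congr1 size E; rewrite size_takel; last by rewrite -ltnS.
  by move=> Ei; case: ne; apply/val_inj.
rewrite big1 // => i _; rewrite !(fw_coef_word F).
case: eqP => [E1|]; case: eqP => [E2|]; rewrite ?mulr0 ?mul0r //.
by rewrite E1 E2 cat_take_drop eqxx in neq.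
Qed.

(** [hom n] is V^(n), and [from n] is the ideal of the elements all of whose
    words have length at least n. *)
Definition hom n x := forall s, size s != n -> cf x s = 0.
Definition from n x := forall s, (size s < n)%N -> cf x s = 0.

Lemma hom_subspace n : is_subspace (hom n).
Proof.
split=> [s _|a x y hx hy s hs]; first exact: cf0.
by rewrite cfD cfZ hx // hy // mulr0 addr0.
Qed.

Lemma from_subspace n : is_subspace (from n).
Proof.
split=> [s _|a x y hx hy s hs]; first exact: cf0.
by rewrite cfD cfZ hx // hy // mulr0 addr0.
Qed.

Lemma hom_from n m x : hom n x -> (m <= n)%N -> from m x.
Proof.
move=> h mn s hs; apply: h; rewrite neq_ltn.
by rewrite (leq_trans hs mn).
Qed.

Lemma hom_wd s : hom (size s) (wd s).
Proof. by move=> t; rewrite (fw_coef_word F); case: (eqVneq s t) => // ->; rewrite eqxx. Qed.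

Lemma cf_homl n x y s : hom n x ->
  cf (x * y) s = if (n <= size s)%N then cf x (take n s) * cf y (drop n s) else 0.
Proof.
move=> hx; rewrite cf_mul; case: leqP => ns.
  have lt : (n < (size s).+1)%N by [].
  rewrite (bigD1 (Ordinal lt)) //= big1 ?addr0 // => i ne.
  rewrite hx ?mul0r // size_takel; last by rewrite -ltnS.
  by apply: contraNneq ne => E; apply/eqP/val_inj.
rewrite big1 // => i _; rewrite hx ?mul0r // size_takel -1?ltnS //.
by rewrite neq_ltn (leq_ltn_trans _ ns) // -ltnS.
Qed.

Lemma cf_homr n x y s : hom n y ->
  cf (x * y) s = if (n <= size s)%N
    then cf x (take (size s - n) s) * cf y (drop (size s - n) s) else 0.
Proof.
move=> hy; rewrite cf_mul; case: leqP => ns.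
  have lt : (size s - n < (size s).+1)%N by rewrite ltnS leq_subr.
  rewrite (bigD1 (Ordinal lt)) //= big1 ?addr0 // => i ne.
  rewrite [cf y _]hy ?mulr0 // size_drop.
  apply: contraNneq ne => E; apply/eqP/val_inj => /=.
  by rewrite -E subKn // -ltnS.
rewrite big1 // => i _; rewrite [cf y _]hy ?mulr0 // size_drop.
by rewrite neq_ltn (leq_ltn_trans (leq_subr _ _) ns).
Qed.

Lemma hom_mul m n x y : hom m x -> hom n y -> hom (m + n)%N (x * y).
Proof.
move=> hx hy s hs; rewrite (cf_homl _ _ hx); case: leqP => // ms.
rewrite [cf y _]hy ?mulr0 // size_drop.
by apply: contraNneq hs => <-; rewrite subnKC.
Qed.

Lemma from_mul m n x y : from m x -> from n y -> from (m + n)%N (x * y).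
Proof.
move=> hx hy s hs; rewrite cf_mul big1 // => i _.
have [lt|le] := ltnP i m.
  rewrite hx ?mul0r // size_takel // -ltnS; exact: ltn_ord.
rewrite [cf y _]hy ?mulr0 // size_drop ltn_subLR; last by rewrite -ltnS.
by rewrite (leq_trans hs) // leq_add2r.
Qed.

(** Two-sided division by words: the coefficient of m in [mid u v x] is that of
    u m v in x. *)
Definition mid u v : T -> T := ext (fun s =>
  if [&& (size u + size v <= size s)%N, take (size u) s == u
       & drop (size s - size v) s == v]
  then wd (drop (size u) (take (size s - size v) s)) else 0).

Lemma mid_linear u v : linear (mid u v).
Proof. exact: fw_lift_linear. Qed.

Lemma cf_mid u v x s : cf (mid u v x) s = cf x (u ++ s ++ v).
Proof.
apply: (cf_ext_eq (c := fun x s => cf x (u ++ s ++ v))) => [t|m t].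
  exact: cf_linear.
rewrite (fw_coef_word F); case: ifP => [/and3P[le /eqP Eu /eqP Ev]|].
  have : m = u ++ drop (size u) (take (size m - size v) m) ++ v.
    rewrite -[LHS](cat_take_drop (size m - size v)) Ev catA; congr (_ ++ _).
    by rewrite -[LHS](cat_take_drop (size u)) take_takel ?Eu //; lia.
  move: (drop _ _) => w ->; rewrite (fw_coef_word F); congr (_%:R); congr (nat_of_bool _).
  apply/eqP/eqP => [->//|/eqP]; rewrite eqseq_cat // eqxx /= => /eqP/(congr1 rev).
  rewrite !rev_cat => /eqP; rewrite eqseq_cat // eqxx /= => /eqP.
  exact: (can_inj revK).
move=> h; rewrite cf0; case: eqP => // E; move: h; rewrite E.
rewrite !size_cat take_size_cat // eqxx /=.
rewrite catA drop_size_cat ?size_cat ?eqxx ?andbT; last first.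
  by rewrite addnA addnK.
by rewrite leq_add2l leq_addl.
Qed.
End Words.

(** * Stripping words and products of subspaces *)

Section Strip.
Context {k : fieldType} {I : finType} {T : lalgType k} (F : free_words I T).
Implicit Types (x y z : T) (s t u v : seq I) (A B C P W : set T).
Local Notation wd := (fw_word F).
Local Notation cf := (fw_coef F).
Local Notation mid := (mid F).
Local Notation hom := (hom F).
Local Notation from := (from F).

Lemma mid_mid u v u' v' x : mid u v (mid u' v' x) = mid (u' ++ u) (v ++ v') x.
Proof. by apply: (fw_coef_inj (f:=F)) => s; rewrite !cf_mid !catA. Qed.

Lemma mid_hom u v n x :
  hom (size u + n + size v)%N x -> hom n (mid u v x).
Proof.
by move=> h s hs; rewrite cf_mid h // !size_cat addnA eqn_add2r eqn_add2l.
Qed.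

Lemma mid_from u v n x :
  from (size u + n + size v)%N x -> from n (mid u v x).
Proof. by move=> h s hs; rewrite cf_mid h // !size_cat; lia. Qed.

Lemma mid_mull n u a y : hom n a -> (size u <= n)%N ->
  mid u [::] (a * y) = mid u [::] a * y.
Proof.
move=> ha un; apply: (fw_coef_inj (f:=F)) => s.
have hm : hom (n - size u)%N (mid u [::] a) by apply: mid_hom; rewrite addn0 subnKC.
rewrite [LHS]cf_mid [LHS](cf_homl _ _ ha) [RHS](cf_homl _ _ hm) cats0 size_cat leq_subLR.
case: ifP => // _; rewrite cf_mid cats0 take_cat drop_cat.
have [lt|_] := ltnP n (size u); first by lia.
by [].
Qed.

Lemma mid_mulr n v y b : hom n b -> (size v <= n)%N ->
  mid [::] v (y * b) = y * mid [::] v b.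
Proof.
move=> hb vn; apply: (fw_coef_inj (f:=F)) => s.
have hm : hom (n - size v)%N (mid [::] v b) by apply: mid_hom; rewrite subnK.
rewrite [LHS]cf_mid [LHS](cf_homr _ _ hb) [RHS](cf_homr _ _ hm) /= size_cat leq_subLR addnC.
case: ifP => // le; rewrite cf_mid /=.
have -> : (size v + size s - n = size s - (n - size v))%N by lia.
have lt : (size s - (n - size v) <= size s)%N by lia.
by rewrite takel_cat // drop_cat; case: ltngtP lt => // E _;
  rewrite ?E ?subnn ?drop0 ?drop_size.
Qed.

Lemma hom0E x : hom 0 x -> x = cf x [::] *: 1.
Proof.
move=> h; apply: (fw_coef_inj (f:=F)) => s; rewrite cfZ -(fw_word_nil F) (fw_coef_word F).
case: s => [|i s] /=; first by rewrite mulr1.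
by rewrite mulr0 h.
Qed.

Lemma mid_full n u a : hom n a -> size u = n -> mid u [::] a = cf a u *: 1.
Proof.
move=> ha un; have hm : hom 0 (mid u [::] a) by apply: mid_hom; rewrite !addn0 un.
by rewrite [LHS](hom0E hm) cf_mid /= cats0.
Qed.

Lemma mid_full_r n v b : hom n b -> size v = n -> mid [::] v b = cf b v *: 1.
Proof.
move=> hb vn; have hm : hom 0 (mid [::] v b) by apply: mid_hom; rewrite !add0n vn.
by rewrite [LHS](hom0E hm) cf_mid.
Qed.

Lemma mid_split u v x : mid u v x = mid [::] v (mid u [::] x).
Proof. by rewrite mid_mid !cats0. Qed.

Lemma mid_mul3 u v a y b : hom (size u) a -> hom (size v) b ->
  mid u v (a * y * b) = (cf a u * cf b v) *: y.
Proof.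
move=> ha hb; rewrite mid_split -mulrA (mid_mull _ ha) // (mid_full ha) //.
rewrite [in LHS](mulr_algl (cf a u) (y * b)) [LHS](linZ (mid_linear F [::] v)).
rewrite [in LHS](mid_mulr y hb) // (mid_full_r hb) // -scalerA; congr (_ *: _).
by rewrite [LHS](fw_scaler_mulr F) [in LHS]mulr1.
Qed.

Lemma sum_tuple_delta n (c : seq I -> k) s :
  \sum_(u : n.-tuple I) (tval u == s)%:R * c u = if size s == n then c s else 0.
Proof.
case: ifP => [hs|/negP hs].
  rewrite (bigD1 (Tuple hs)) //= eqxx mul1r big1 ?addr0 // => u ne.
  case: eqP => [E|]; last by rewrite mul0r.
  by case/eqP: ne; apply/val_inj.
rewrite big1 // => u _; case: eqP => [E|]; last by rewrite mul0r.
by case: hs; rewrite -E size_tuple.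
Qed.

Lemma hom_expand n x : hom n x -> x = \sum_(u : n.-tuple I) cf x u *: wd u.
Proof.
move=> hx; apply: (fw_coef_inj (f:=F)) => s; rewrite cf_sum.
under eq_bigr do rewrite cfZ (fw_coef_word F) mulrC.
by rewrite sum_tuple_delta; case: eqP => // /eqP/hx.
Qed.

Lemma expandl n x : from n x ->
  x = \sum_(u : n.-tuple I) wd u * mid u [::] x.
Proof.
move=> hx; apply: (fw_coef_inj (f:=F)) => s; rewrite cf_sum.
have E (u : n.-tuple I) : cf (wd u * mid u [::] x) s =
  (tval u == take n s)%:R * (if (n <= size s)%N then cf x (u ++ drop n s) else 0).
  have hu : hom n (wd u : T) by rewrite -[X in hom X _](size_tuple u); apply: (hom_wd F).
  rewrite (cf_homl _ _ hu); case: leqP => _; last by rewrite mulr0.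
  by rewrite (fw_coef_word F) cf_mid cats0.
rewrite (eq_bigr _ (fun w _ => E w)).
rewrite (sum_tuple_delta _ (fun w => if (n <= size s)%N then cf x (w ++ drop n s) else 0)).
case: leqP => ns; last by rewrite if_same hx.
by rewrite size_takel // eqxx cat_take_drop.
Qed.

Lemma expandr n x : from n x ->
  x = \sum_(v : n.-tuple I) mid [::] v x * wd v.
Proof.
move=> hx; apply: (fw_coef_inj (f:=F)) => s; rewrite cf_sum.
have E (v : n.-tuple I) : cf (mid [::] v x * wd v) s =
  (tval v == drop (size s - n) s)%:R *
  (if (n <= size s)%N then cf x (take (size s - n) s ++ v) else 0).
  have hv : hom n (wd v : T) by rewrite -[X in hom X _](size_tuple v); apply: (hom_wd F).
  rewrite (cf_homr _ _ hv); case: leqP => _; last by rewrite mulr0.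
  by rewrite (fw_coef_word F) cf_mid mulrC.
rewrite (eq_bigr _ (fun w _ => E w)).
rewrite (sum_tuple_delta _
  (fun w => if (n <= size s)%N then cf x (take (size s - n) s ++ w) else 0)).
case: leqP => ns; last by rewrite if_same hx.
by rewrite size_drop subKn // eqxx cat_take_drop.
Qed.

(** Taylor expansion: an element without words shorter than l + r is recovered
    from what remains when the outer words are stripped. *)
Lemma expand l r x : from (l + r)%N x ->
  x = \sum_(u : l.-tuple I) \sum_(v : r.-tuple I) wd u * mid u v x * wd v.
Proof.
move=> hx; rewrite {1}[x](@expandl l).
  apply: eq_bigr => u _; rewrite {1}[mid u [::] x](@expandr r).
    by rewrite mulr_sumr; apply: eq_bigr => v _; rewrite mulrA mid_mid !cats0.
  by apply: mid_from; rewrite addn0 size_tuple.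
by move=> s hs; apply: hx; rewrite ltn_addr.
Qed.

Lemma strip_eq0l n x : from n x ->
  (forall u, size u = n -> mid u [::] x = 0) -> x = 0.
Proof.
move=> hx h; rewrite [x](expandl hx) big1 // => u _.
by rewrite h ?mulr0 // size_tuple.
Qed.

Lemma strip_eq0r n x : from n x ->
  (forall v, size v = n -> mid [::] v x = 0) -> x = 0.
Proof.
move=> hx h; rewrite [x](expandr hx) big1 // => v _.
by rewrite h ?mul0r // size_tuple.
Qed.

(** The product of subspaces and its unit as in [prodS] and [unitS], for any
    algebra in place of T(V). *)
Definition mulS A B : set T := span [set x * y | x in A & y in B].
Definition oneS : set T := span [set 1].
Local Notation "A ** B" := (mulS A B) (at level 40, left associativity).

Lemma mulS_subspace A B : is_subspace (A ** B).
Proof. exact: span_subspace. Qed.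

Lemma mulS_mul A B x y : A x -> B y -> (A ** B) (x * y).
Proof. by move=> Ax By; apply: sub_span; exists x => //; exists y. Qed.

Lemma mulS_min A B P : is_subspace P ->
  (forall x y, A x -> B y -> P (x * y)) -> A ** B `<=` P.
Proof.
move=> hP h; apply: span_min => // _ [x Ax [y By <-]]; exact: h.
Qed.

Lemma mulSS A B A' B' : A `<=` A' -> B `<=` B' -> A ** B `<=` A' ** B'.
Proof.
move=> AA BB; apply: mulS_min; first exact: mulS_subspace.
by move=> x y /AA Ax /BB By; apply: mulS_mul.
Qed.

Lemma mulSA A B C : A ** (B ** C) = A ** B ** C.
Proof.
apply/seteqP; split; apply: mulS_min; try exact: mulS_subspace.
  move=> x y Ax; move: y.
  apply: mulS_min.
    by apply: (subspace_preim (mulT_linearr F x)); apply: mulS_subspace.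
  by move=> y z By Cz; rewrite mulrA; apply: mulS_mul => //; apply: mulS_mul.
move=> x z ABx Cz; move: x ABx.
apply: mulS_min.
  by apply: (subspace_preim (mulT_linearl z)); apply: mulS_subspace.
by move=> x y Ax By; rewrite -mulrA; apply: mulS_mul => //; apply: mulS_mul.
Qed.

Lemma oneSP x : oneS x <-> exists c, x = c *: 1.
Proof.
split; last first.
  by move=> [c ->]; apply: (subspaceZ (span_subspace _)); apply: sub_span.
move: x; apply: span_min => [|_ ->]; last by exists 1; rewrite scale1r.
split=> [|a _ _ [c ->] [d ->]]; first by exists 0; rewrite scale0r.
by exists (a * c + d); rewrite scalerDl scalerA.
Qed.

Lemma mulS1 A : is_subspace A -> A ** oneS = A.
Proof.
move=> hA; apply/seteqP; split=> [|x Ax].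
  apply: mulS_min => // x _ Ax /oneSP[c ->].
  by rewrite (fw_scaler_mulr F) mulr1; apply: (subspaceZ hA).
rewrite -[x]mulr1; apply: mulS_mul => //.
by apply: sub_span.
Qed.

Lemma mul1S A : is_subspace A -> oneS ** A = A.
Proof.
move=> hA; apply/seteqP; split=> [|x Ax].
  apply: mulS_min => // _ x /oneSP[c ->] Ax.
  by rewrite -scalerAl mul1r; apply: (subspaceZ hA).
rewrite -[x]mul1r; apply: mulS_mul => //.
by apply: sub_span.
Qed.

Lemma oneSE : oneS = hom 0 :> set T.
Proof.
apply/seteqP; split=> x; last by move=> /hom0E ->; apply/oneSP; exists (cf x [::]).
move=> /oneSP[c ->]; apply: (subspaceZ (hom_subspace F _)).
rewrite -(fw_word_nil F); exact: (@hom_wd _ _ _ F [::]).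
Qed.

Lemma prod_hom m n : hom m ** hom n = hom (m + n)%N :> set T.
Proof.
apply/seteqP; split.
  apply: mulS_min; first exact: (hom_subspace F).
  by move=> x y; apply: hom_mul.
move=> x hx; rewrite [x](hom_expand hx).
apply: subspace_sum; first exact: mulS_subspace.
move=> u _; apply: (subspaceZ (mulS_subspace _ _)).
rewrite -(cat_take_drop m u) (fw_word_cat F); apply: mulS_mul.
  rewrite -[X in hom X](_ : size (take m u) = m); first exact: (hom_wd F).
  by rewrite size_takel // size_tuple leq_addr.
rewrite -[X in hom X](_ : size (drop m u) = n); first exact: (hom_wd F).
by rewrite size_drop size_tuple addKn.
Qed.

(** As the words of fixed length are independent, membership in V^(l) W V^(r) is
    tested by stripping words; an intersection of such spaces then becomes a
    conjunction of conditions on the stripped elements. *)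
Lemma sandwichP l r W : is_subspace W -> forall x,
  (hom l ** W ** hom r) x <-> from (l + r)%N x /\
    (forall u v, size u = l -> size v = r -> W (mid u v x)).
Proof.
move=> hW x; split; last first.
  move=> [/expand E h]; rewrite E; apply: subspace_sum => [|u _]; first exact: mulS_subspace.
  apply: subspace_sum => [|v _]; first exact: mulS_subspace.
  apply: mulS_mul; last by rewrite -[X in hom X](size_tuple v); apply: (hom_wd F).
  apply: mulS_mul; first by rewrite -[X in hom X](size_tuple u); apply: (hom_wd F).
  by apply: h; rewrite size_tuple.
pose Q := [set x | from (l + r)%N x /\
    (forall u v, size u = l -> size v = r -> W (mid u v x))].
have hQ : is_subspace Q.
  split=> [|c y z [fy hy] [fz hz]]; split.
  - exact: subspace0 (from_subspace F _).
  - by move=> u v _ _; rewrite (lin0 (mid_linear F u v)); apply: (subspace0 hW).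
  - exact: (from_subspace F _).2.
  - by move=> u v ul vr; rewrite mid_linear; apply: hW.2; [apply: hy|apply: hz].
rewrite -mulSA; move: x; apply: (@mulS_min _ _ Q) => // a z ha; move: z.
apply: (@mulS_min _ _ [set z | Q (a * z)]).
  exact: (subspace_preim (mulT_linearr F a)).
move=> y b Wy hb; rewrite /= mulrA; split.
  apply: from_mul; last exact: (hom_from hb).
  rewrite -[l]addn0; apply: from_mul; [exact: (hom_from ha)|by []].
move=> u v ul vr; rewrite mid_mul3 ?ul ?vr //; exact: (subspaceZ hW).
Qed.

Lemma sandwichlP l W : is_subspace W -> forall x,
  (hom l ** W) x <-> from l x /\ (forall u, size u = l -> W (mid u [::] x)).
Proof.
move=> hW x.
have -> : hom l ** W = hom l ** W ** hom 0.
  by rewrite -oneSE mulS1 //; apply: mulS_subspace.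
split=> [/(sandwichP l 0 hW)|[fx h]].
  by rewrite addn0 => -[fx h]; split=> // u ul; apply: h.
apply/(sandwichP l 0 hW); rewrite addn0; split=> // u v ul /eqP/nilP ->; exact: h.
Qed.

Lemma sandwichrP r W : is_subspace W -> forall x,
  (W ** hom r) x <-> from r x /\ (forall v, size v = r -> W (mid [::] v x)).
Proof.
move=> hW x.
have -> : W ** hom r = hom 0 ** W ** hom r by rewrite -oneSE mul1S.
split=> [/(sandwichP 0 r hW)|[fx h]].
  by rewrite add0n => -[fx h]; split=> // v vr; apply: h.
apply/(sandwichP 0 r hW); rewrite add0n; split=> // u v /eqP/nilP -> vr; exact: h.
Qed.
End Strip.

(** * Finite sums and homogeneous parts *)

Section Series.
Context {k : fieldType} {M : lmodType k}.
Implicit Types (x y : M) (f g : nat -> M).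

(** The partial sums are constant from some index on; so f has finite support,
    and x is its sum. *)
Definition series f x : Prop :=
  exists n0, forall n, (n0 <= n)%N -> x = \sum_(i < n) f i.

Lemma series_lin c f x g y :
  series f x -> series g y -> series (fun i => c *: f i + g i) (c *: x + y).
Proof.
move=> [m hm] [n hn]; exists (maxn m n) => p; rewrite geq_max => /andP[mp np].
by rewrite (hm p) // (hn p) // scaler_sumr -big_split.
Qed.

Lemma series_single i x : series (fun j => if j == i then x else 0) x.
Proof.
exists i.+1 => n lt; rewrite (bigD1 (Ordinal lt)) //= eqxx big1 ?addr0 //.
by move=> j; rewrite -val_eqE /= => /negPf ->.
Qed.

Lemma seriesB f x g y :
  series f x -> series g y -> series (fun i => f i - g i) (x - y).
Proof.
move=> [m hm] [n hn]; exists (maxn m n) => p; rewrite geq_max => /andP[mp np].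
by rewrite (hm p) // (hn p) // sumrB.
Qed.

Lemma sum_ord_bounded m n f : (n <= m)%N -> (forall i, (n <= i)%N -> f i = 0) ->
  \sum_(i < m) f i = \sum_(i < n) f i.
Proof.
move=> nm h; rewrite -!(big_mkord xpredT f) (big_cat_nat (leq0n n) nm) /=.
rewrite -[RHS]addr0; congr (_ + _).
by rewrite big_nat_cond big1 // => i /andP[/andP[/h]].
Qed.

End Series.

Section Parts.
Context {k : fieldType} {I : finType} {T : lalgType k} (F : free_words I T).
Implicit Types (x y z : T) (s t u v : seq I) (A B C P W : set T).
Local Notation wd := (fw_word F).
Local Notation cf := (fw_coef F).
Local Notation mid := (mid F).
Local Notation hom := (hom F).
Local Notation from := (from F).
Local Notation "A ** B" := (mulS A B) (at level 40, left associativity).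

Definition proj n : T -> T :=
  fw_lift F (fun s => if size s == n then wd s else 0).

Lemma proj_linear n : linear (proj n).
Proof. exact: fw_lift_linear. Qed.

Lemma cf_proj n x s : cf (proj n x) s = if size s == n then cf x s else 0.
Proof.
apply: (cf_ext_eq (c := fun x s => if size s == n then cf x s else 0)).
  move=> t c y z /=; case: ifP => _; first exact: cf_linear.
  by rewrite scaler0 addr0.
move=> s' t; case sn: (size s' == n); case tn: (size t == n);
  rewrite ?cf0 ?(fw_coef_word F) //; case: eqP => // st;
  by rewrite st tn in sn.
Qed.

Lemma proj_hom n x : hom n (proj n x).
Proof. by move=> s /negPf ns; rewrite cf_proj ns. Qed.

Lemma hom_proj n x : hom n x -> proj n x = x.
Proof.
move=> hx; apply: (fw_coef_inj (f := F)) => s; rewrite cf_proj.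
by case: eqP => // /eqP/hx.
Qed.

Lemma proj_from n m x : from m x -> (n < m)%N -> proj n x = 0.
Proof.
move=> hx nm; apply: (fw_coef_inj (f := F)) => s; rewrite cf_proj cf0.
by case: eqP => // sn; apply: hx; rewrite sn.
Qed.

Lemma proj_other n m x : hom m x -> n != m -> proj n x = 0.
Proof.
move=> hx nm; apply: (fw_coef_inj (f := F)) => s; rewrite cf_proj cf0.
by case: eqP => // sn; apply: hx; rewrite sn.
Qed.

Lemma proj_eq0 x : (forall n, proj n x = 0) -> x = 0.
Proof.
move=> h; apply: (fw_coef_inj (f := F)) => s.
by rewrite cf0 -(cf0 F s) -(h (size s)) cf_proj eqxx.
Qed.

Lemma mid_proj u v n x :
  mid u v (proj (size u + n + size v)%N x) = proj n (mid u v x).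
Proof.
apply: (fw_coef_inj (f := F)) => s; rewrite cf_mid !cf_proj cf_mid !size_cat.
by rewrite addnA eqn_add2r eqn_add2l.
Qed.

Lemma proj_mull m n x y : hom m x -> proj (m + n)%N (x * y) = x * proj n y.
Proof.
move=> hx; apply: (fw_coef_inj (f := F)) => s.
rewrite cf_proj !(cf_homl _ _ hx) cf_proj size_drop.
case: leqP => ms; last by rewrite if_same.
by rewrite -(eqn_add2l m (size s - m)) subnKC //; case: eqP; rewrite ?mulr0.
Qed.

Lemma proj_series x : series (proj^~ x) x.
Proof.
have [n0 h0] := fw_coef_finite F x; exists n0 => n nn.
apply: (fw_coef_inj (f := F)) => s; rewrite cf_sum.
have [lt|le] := ltnP (size s) n.
  rewrite (bigD1 (Ordinal lt)) //= cf_proj eqxx big1 ?addr0 // => i.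
  by rewrite cf_proj -val_eqE /= eq_sym => /negPf ->.
rewrite h0 ?(leq_trans nn) // big1 // => i _; rewrite cf_proj.
case: eqP => // E; move: (ltn_ord i); lia.
Qed.

Lemma mid_nil x : mid [::] [::] x = x.
Proof. by apply: (fw_coef_inj (f := F)) => s; rewrite cf_mid cats0. Qed.

(** Every subspace W of finitely supported elements is the image of an
    idempotent linear map p.  By induction on the support there is one for the
    elements of W without the word m; if some y in W contains m, it is extended
    by the projection along the coefficient of m onto the line of y. *)
Lemma retraction_support (L : seq (seq I)) W : is_subspace W ->
  (forall x, W x -> forall s, s \notin L -> cf x s = 0) ->
  exists p : T -> T, [/\ linear p, forall x, W (p x) & forall x, W x -> p x = x].
Proof.
elim: L W => [|m L IHL] W hW supp.
  exists (fun=> 0); split=> [c x y|_|x Wx]; first by rewrite scaler0 addr0.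
    exact: subspace0.
  by apply: (fw_coef_inj (f := F)) => s; rewrite cf0 (supp x).
pose W' := W `&` [set x | cf x m = 0].
have hW' : is_subspace W'.
  apply: subspaceI => //; split=> [|c x y /= cx cy]; first exact: cf0.
  by rewrite cfD cfZ cx cy mulr0 addr0.
have [|p [pl pW pid]] := IHL W' hW'.
  move=> x [Wx cx] s sL; have [->//|sm] := eqVneq s m.
  by apply: (supp x) => //; rewrite in_cons negb_or sm.
have [all0|/existsNP[y /not_implyP[Wy /eqP cy]]] :=
  pselect (forall x, W x -> cf x m = 0).
  exists p; split=> // [x|x Wx]; first by have [] := pW x.
  by apply: pid; split=> //; apply: all0.
pose c x := cf x m / cf y m.
have cl b x z : c (b *: x + z) = b * c x + c z.
  by rewrite /c cfD cfZ mulrDl mulrA.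
exists (fun x => p (x - c x *: y) + c x *: y); split=> [b x z|x|x Wx].
- rewrite cl scalerDl opprD addrACA -scalerA -scalerBr pl scalerDr.
  by rewrite -!addrA; congr (_ + _); rewrite addrCA.
- apply: (subspaceD hW); first by have [] := pW (x - c x *: y).
  exact: (subspaceZ hW).
- rewrite pid ?subrK //; split=> /=.
    by apply: (subspaceB hW) => //; apply: (subspaceZ hW).
  by rewrite cfB cfZ /c divfK // subrr.
Qed.

Lemma retraction n W : is_subspace W -> W `<=` hom n ->
  exists p : T -> T, [/\ linear p, forall x, W (p x) & forall x, W x -> p x = x].
Proof.
move=> hW Wn.
apply: (@retraction_support [seq tval w | w <- enum {: n.-tuple I}]) => //.
move=> x /Wn hx s sn; apply: hx; apply: contraNN sn => sn.
by apply/mapP; exists (Tuple sn); rewrite ?mem_enum.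
Qed.

(** The instance (W1 T) cap (T W2) = W1 W2 of the fact that tensor products
    over a field commute with finite intersections: a projection p onto W1,
    applied to the left factors of x in V^(a) V^(b), fixes x and maps the
    words of length a, whose coefficients are in W2, into W1. *)
Lemma mulS_cap a b W1 W2 x : is_subspace W1 -> is_subspace W2 ->
  W1 `<=` hom a -> hom (a + b)%N x ->
  (forall v, size v = b -> W1 (mid [::] v x)) ->
  (forall u, size u = a -> W2 (mid u [::] x)) -> (W1 ** W2) x.
Proof.
move=> h1 h2 W1a hx hv hu; have [p [pl pW pid]] := retraction h1 W1a.
have E : x = \sum_(u : a.-tuple I) p (wd u) * mid u [::] x.
  rewrite {1}[x](@expandr _ _ _ F b); last by apply: hom_from hx _; rewrite leq_addl.
  transitivity (\sum_(v : b.-tuple I) \sum_(u : a.-tuple I)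
      cf x (u ++ v) *: (p (wd u) * wd v)).
    apply: eq_bigr => v _; have Wv := hv v (size_tuple v).
    rewrite -[in LHS](pid _ Wv) {1}(hom_expand (W1a _ Wv)) (lin_sum pl) mulr_suml.
    by apply: eq_bigr => u _; rewrite (linZ pl) cf_mid scalerAl.
  rewrite exchange_big; apply: eq_bigr => u _ /=.
  rewrite [in RHS](@hom_expand _ _ _ F b (mid u [::] x)); last first.
    by apply: mid_hom; rewrite size_tuple addn0.
  rewrite mulr_sumr; apply: eq_bigr => v _.
  by rewrite cf_mid cats0 (fw_scaler_mulr F).
rewrite E; apply: subspace_sum; first exact: mulS_subspace.
by move=> u _; apply: mulS_mul => //; apply: hu; rewrite size_tuple.
Qed.
End Parts.

(** * Spaces of relations and chains of relations *)

Section Relations.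
Context {k : fieldType} {I : finType} {T : lalgType k} (F : free_words I T).
Implicit Types (x y z : T) (s n : nat) (u v : seq I) (A B C P W : set T).
Local Notation wd := (fw_word F).
Local Notation cf := (fw_coef F).
Local Notation mid := (mid F).
Local Notation hom := (hom F).
Local Notation from := (from F).
Local Notation proj := (proj F).
Local Notation "A ** B" := (mulS A B) (at level 40, left associativity).

Lemma homogeneous_mulS s n W x : (s <= n)%N -> W `<=` hom s ->
  (W ** setT) x -> (W ** hom (n - s)%N) (proj n x).
Proof.
move=> sn Ws; move: x; apply: (@mulS_min _ _ _ _ [set x | (_ ** _) (proj n x)]).
  by apply: (subspace_preim (proj_linear F n)); apply: mulS_subspace.
move=> x y Wx _ /=; rewrite -{2}(subnKC sn) (proj_mull _ _ (Ws _ Wx)).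
by apply: mulS_mul => //; apply: proj_hom.
Qed.

Lemma mulS_proj A B : (forall n x, A x -> A (proj n x)) ->
  (forall n x, B x -> B (proj n x)) ->
  forall n x, (A ** B) x -> (A ** B) (proj n x).
Proof.
move=> hA hB n; apply: (@mulS_min _ _ _ _ [set x | (_ ** _) (proj n x)]).
  by apply: (subspace_preim (proj_linear F n)); apply: mulS_subspace.
move=> x y Ax By /=; have [m h] := proj_series F x.
rewrite [x](h m) // mulr_suml (lin_sum (proj_linear F n)).
apply: subspace_sum => [|i _]; first exact: mulS_subspace.
have [ilen|nlti] := leqP i n.
  rewrite -(subnKC ilen) (proj_mull _ _ (@proj_hom _ _ _ F i x)).
  by apply: mulS_mul; [apply: hA|apply: hB].
rewrite (@proj_from _ _ _ F n i) //; first exact: subspace0 (mulS_subspace _ _).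
have hi : from i (proj i x) by apply: (hom_from (proj_hom F x) (leqnn i)).
by have := from_mul hi (_ : from 0 y); rewrite addn0; apply.
Qed.

Variable R : set T.
Hypothesis R_subspace : is_subspace R.
Hypothesis R_proj : forall n x, R x -> R (proj n x).
Hypothesis R_minl : forall x, R x -> (from 1 ** R ** setT) x -> x = 0.
Hypothesis R_minr : forall x, R x -> (R ** from 1) x -> x = 0.

Local Notation Rs s := (R `&` hom s).

Lemma Rs_subspace s : is_subspace (Rs s).
Proof. by apply: subspaceI => //; apply: hom_subspace. Qed.

Lemma Rs_from s x : (Rs s ** setT) x -> from s x.
Proof.
move: x; apply: mulS_min; first exact: from_subspace.
move=> x y [_ hx] _; rewrite -[s]addn0; apply: from_mul => //.
exact: (hom_from hx).
Qed.

Lemma proj_Rs_mul s n x : (Rs s ** setT) x -> (Rs s ** setT) (proj n x).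
Proof.
have [sn|ns] := leqP s n.
  move=> /(homogeneous_mulS sn (@subIsetr _ _ _)).
  by apply: mulSS => //; apply: subIset.
move=> /Rs_from Rx; rewrite (proj_from Rx ns).
exact: subspace0 (mulS_subspace _ _).
Qed.

(** In length n, stripping the last n - s letters leaves a relation if the
    element is in R_s T, and an element of R T_(>0) if it is in R_t T with t < s
    ([strip_Rs_lt]).  This contrast makes the R_s T independent. *)
Lemma strip_Rs s n v x : hom n x -> (s <= n)%N -> size v = (n - s)%N ->
  (Rs s ** setT) x -> R (mid [::] v x).
Proof.
move=> hx sn vn /(homogeneous_mulS sn (@subIsetr _ _ _)).
rewrite (hom_proj hx) => /sandwichrP h.
by have [_ /(_ v vn)[]] := h (Rs_subspace s).
Qed.

Lemma strip_Rs_lt s t n v x : hom n x -> (s <= n)%N -> (t < s)%N ->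
  size v = (n - s)%N -> (Rs t ** setT) x -> (R ** from 1) (mid [::] v x).
Proof.
move=> hx sn ts vn; have tn : (t <= n)%N by lia.
move=> /(homogeneous_mulS tn (@subIsetr _ _ _)); rewrite (hom_proj hx).
move: x {hx}; apply: (@mulS_min _ _ _ _ [set x | (_ ** _) (mid [::] v x)]).
  by apply: (subspace_preim (mid_linear F _ _)); apply: mulS_subspace.
move=> x y [Rx _] hy /=; rewrite (mid_mulr _ hy); last by lia.
apply: mulS_mul => //; apply: (@hom_from _ _ _ F (s - t)%N); last by lia.
by apply: mid_hom; rewrite vn (_ : (_ + _ + _ = n - t)%N) //=; lia.
Qed.

(** The sum of the right ideals R_s T is direct: among the nonzero summands of
    a relation take the one with s maximal; its part of degree n, stripped of
    its last n - s letters, lies in R and in R T_(>0). *)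
Lemma Rs_independent n (f : 'I_n -> T) (sg : 'I_n -> nat) :
  (forall i, f i != 0 -> (Rs (sg i) ** setT) (f i)) ->
  (forall i j, f i != 0 -> f j != 0 -> sg i = sg j -> i = j) ->
  \sum_i f i = 0 -> forall i, f i = 0.
Proof.
move=> hf sgI sum0 i; apply: (proj_eq0 (F := F)) => d.
pose g j := proj d (f j).
have gf j : g j != 0 -> f j != 0.
  by apply: contraNneq; rewrite /g => ->; rewrite (lin0 (proj_linear F d)).
have hg j : g j != 0 -> (Rs (sg j) ** setT) (g j).
  by move=> /gf/hf; apply: proj_Rs_mul.
have gd j : hom d (g j) by apply: proj_hom.
have gsum : \sum_j g j = 0.
  by rewrite -(lin_sum (proj_linear F d)) sum0 (lin0 (proj_linear F d)).
have [//|gi] := eqVneq (proj d (f i)) 0.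
case: (@arg_maxnP _ i (fun j => g j != 0) sg gi) => m gm max_m.
have sd : (sg m <= d)%N.
  rewrite leqNgt; apply/negP => ds; case/eqP: (gm).
  by rewrite -(hom_proj (gd m)) (proj_from (Rs_from (hg m gm)) ds).
suff: g m = 0 by move/eqP: gm.
apply: (strip_eq0r (F := F) (n := (d - sg m)%N)).
  by apply: hom_from (gd m) _; rewrite leq_subr.
move=> v vd; apply: R_minr; first exact: strip_Rs (gd m) sd vd (hg m gm).
move/eqP: gsum; rewrite (bigD1 m) //= addr_eq0 => /eqP ->.
rewrite -sumrN (lin_sum (mid_linear F _ _)).
apply: subspace_sum => [|j jm]; first exact: mulS_subspace.
rewrite (linN (mid_linear F _ _)) -scaleN1r.
apply: (subspaceZ (mulS_subspace _ _)).
have [->|gj] := eqVneq (g j) 0.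
  by rewrite (lin0 (mid_linear F _ _)); apply: subspace0 (mulS_subspace _ _).
apply: (strip_Rs_lt (gd j) sd _ vd (hg j gj)).
rewrite ltn_neqAle (max_m j gj : (sg j <= sg m)%N) andbT; apply: contraNneq jm => E.
by apply/eqP/sgI; [exact: gf|exact: gf|].
Qed.

Lemma series_independent (f : nat -> T) :
  (forall s, (Rs s ** setT) (f s)) -> series f 0 -> forall s, f s = 0.
Proof.
move=> hf [n0 sum0] s.
have := @Rs_independent (maxn n0 s.+1) (fun i => f i) (@nat_of_ord _).
move=> h; have lt : (s < maxn n0 s.+1)%N by rewrite leq_max ltnSn orbT.
apply: (h _ _ _ (Ordinal lt)) => [i _|i j _ _|]; first exact: hf.
  exact: val_inj.
by rewrite -sum0 // leq_max leqnn.
Qed.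

Lemma R_mul_parts W x : is_subspace W -> (R ** W) x ->
  exists2 g, series g x & forall s, (Rs s ** W) (g s).
Proof.
move=> hW; move: x; apply: mulS_min.
  split=> [|c x y [f fx hf] [g gy hg]].
    exists (fun=> 0); first by exists 0%N => n _; rewrite big1.
    by move=> s; apply: subspace0 (mulS_subspace _ _).
  exists (fun i => c *: f i + g i); first exact: series_lin.
  by move=> s; apply: (mulS_subspace _ _).2.
move=> x y Rx Wy; exists (fun s => proj s x * y).
  have [n0 h0] := proj_series F x; exists n0 => n /h0 {1}->.
  by rewrite mulr_suml.
by move=> s; apply: mulS_mul => //; split; [apply: R_proj|apply: proj_hom].
Qed.

(** For n = n_s(i) this is the summand of index s of the space of Herscovich and
    Rey; for n < s it is all of V^(n). *)
Definition chainR s n : set T := [set x | hom n x /\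
  forall u v, (size u + s + size v)%N = n -> R (mid u v x)].

Lemma chainR_subspace s n : is_subspace (chainR s n).
Proof.
split=> [|c x y [hx Rx] [hy Ry]]; split.
- exact: subspace0 (hom_subspace F n).
- by move=> u v _; rewrite (lin0 (mid_linear F _ _)); apply: subspace0.
- exact: (hom_subspace F n).2.
- by move=> u v E; rewrite mid_linear; apply: R_subspace.2; [apply: Rx|apply: Ry].
Qed.

Lemma chainR_hom s n : chainR s n `<=` hom n.
Proof. by move=> x []. Qed.

Lemma chainR_self s x : chainR s s x <-> R x /\ hom s x.
Proof.
split=> [[hx h]|[Rx hx]].
  by split=> //; rewrite -[x](mid_nil F); apply: h; rewrite addn0.
split=> // u v E; have /nilP -> : size u == 0%N by lia.
have /nilP -> : size v == 0%N by lia.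
by rewrite mid_nil.
Qed.

Lemma chainR_small s n : (n < s)%N -> chainR s n = hom n.
Proof.
move=> ns; apply/seteqP; split; first exact: chainR_hom.
by move=> x hx; split=> // u v E; lia.
Qed.

Lemma chainR_mid s n u v x : chainR s (size u + n + size v)%N x ->
  chainR s n (mid u v x).
Proof.
move=> [hx h]; split; first exact: mid_hom.
by move=> u' v' E; rewrite mid_mid; apply: h; rewrite !size_cat; lia.
Qed.

(** The reason why these spaces lie in all the products defining J_i. *)
Lemma chainR_cat s m n : chainR s (m + n)%N `<=` chainR s m ** chainR s n.
Proof.
move=> x hx; apply: (@mulS_cap _ _ _ F m n).
- exact: chainR_subspace.
- exact: chainR_subspace.
- exact: chainR_hom.
- exact: (chainR_hom hx).
- by move=> v vn; apply: chainR_mid; rewrite vn.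
- by move=> u um; apply: chainR_mid; rewrite um addn0.
Qed.

Lemma chainR_Rs s n x : (s <= n)%N -> chainR s n x -> (Rs s ** setT) x.
Proof.
move=> sn; rewrite -{1}(subnKC sn) => /chainR_cat.
by apply: mulSS => // y /chainR_self.
Qed.

Definition powR j : set T := iter j (mulS R) (oneS (T := T)).

Lemma powR_subspace j : is_subspace (powR j).
Proof. by case: j => [|j]; [apply: span_subspace|apply: mulS_subspace]. Qed.

Lemma powR_proj j n x : powR j x -> powR j (proj n x).
Proof.
elim: j n x => [|j IHj] n x; last by apply: mulS_proj.
rewrite /powR /= (oneSE F) => hx.
have [->|n0] := eqVneq n 0%N; first by rewrite hom_proj.
by rewrite (proj_other hx n0); apply: subspace0 (hom_subspace F 0).
Qed.

Lemma chainR_powR s j : (0 < s)%N -> chainR s (s * j)%N `<=` powR j.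
Proof.
move=> s0; elim: j => [|j IHj].
  by rewrite muln0 chainR_small // -oneSE.
rewrite mulnS => x /chainR_cat; apply: mulSS => // y /chainR_self[] //.
Qed.

(** The element lies in R_s T and so, the R_t T being independent, in R_s R^(j).
    Stripping s letters leads to chainR s (n - s) and R^(j), where induction
    applies if n >= 2 s.  If n < 2 s and j > 0, stripping n - s letters leads to
    elements of both R and T_(>0) R T, which are 0. *)
Lemma chainR_powR_degree s j n x : (0 < s)%N -> (s <= n)%N ->
  chainR s n x -> powR j.+1 x -> x = 0 \/ n = (s * j.+1)%N.
Proof.
move=> s0; elim: j n x => [|j IHj] n x sn hx.
  rewrite /powR /= (mulS1 F) // muln1 => Rx.
  have [|ne] := eqVneq n s; [by right|left].
  apply: R_minr => //; move: hx; rewrite -(subnKC sn) => /chainR_cat.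
  apply: mulSS => [y /chainR_self[]|y /chainR_hom hy] //.
  by apply: hom_from hy _; lia.
have hxs := chainR_Rs sn hx.
move=> /(R_mul_parts (powR_subspace j.+1))[g gx hg].
have {g gx hg} hxR : (Rs s ** powR j.+1) x.
  suff <- : g s = x by [].
  apply/eqP; rewrite -subr_eq0; apply/eqP.
  have := @series_independent (fun i => g i - (if i == s then x else 0)).
  move=> /(_ _ _ s); rewrite eqxx; apply.
    move=> t; apply: (subspaceB (mulS_subspace _ _)).
      by apply: mulSS (hg t).
    by case: eqP => [->|_] //; apply: subspace0 (mulS_subspace _ _).
  by have := seriesB gx (series_single s x); rewrite subrr.
have [E|/eqP ne] := eqVneq n (s * j.+2)%N; [by right|left].
have x_from m : (m <= n)%N -> from m x by apply: hom_from (chainR_hom hx).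
have [s2|n2] := leqP (s + s)%N n.
  apply: (@strip_eq0l _ _ _ F s _ (x_from s sn)) => u us.
  have hm : chainR s (n - s)%N (mid u [::] x).
    by apply: chainR_mid; rewrite us addn0 subnKC.
  have hR : powR j.+1 (mid u [::] x).
    have /(sandwichlP F _ (powR_subspace j.+1))[_ h] : (hom s ** powR j.+1) x.
      by apply: mulSS hxR => // y [].
    exact: h.
  have le : (s <= n - s)%N by lia.
  by case: (IHj _ _ le hm hR) => // E; case: ne; rewrite mulnS -E subnKC.
apply: (@strip_eq0l _ _ _ F (n - s)%N); first by apply: x_from; rewrite leq_subr.
move=> u un; apply: R_minl.
  by apply: (hx.2 u [::]); rewrite un addn0 subnK.
rewrite -(mulSA F); move: x hxR {hx hxs ne x_from}.
apply: (@mulS_min _ _ _ _ [set x | (_ ** _) (mid u [::] x)]).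
  by apply: (subspace_preim (mid_linear F _ _)); apply: mulS_subspace.
move=> r y [_ hr] hy /=; rewrite (mid_mull _ hr); last by lia.
apply: mulS_mul; last by apply: mulSS hy.
apply: (@hom_from _ _ _ F (s - (n - s))%N); last by lia.
by apply: mid_hom; rewrite un (_ : (_ + _ + _ = s)%N) //=; lia.
Qed.

(** Independence of the R_s T identifies the given components f s with those
    coming from R^(i+1), so that [chainR_powR_degree] applies to each f s. *)
Lemma powR_chainR_series i n (f : nat -> T) x : series f x -> powR i.+1 x ->
  (forall s, f s = 0 \/ [/\ (0 < s)%N, (s <= n)%N & chainR s n (f s)]) ->
  forall s, f s = 0 \/ n = (s * i.+1)%N.
Proof.
move=> fx /(R_mul_parts (powR_subspace i))[g gx hg] hf s.
have fRs t : (Rs t ** setT) (f t).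
  case: (hf t) => [->|[_ tn ht]]; first exact: subspace0 (mulS_subspace _ _).
  exact: chainR_Rs ht.
have fg : f s = g s.
  apply/eqP; rewrite -subr_eq0; apply/eqP.
  apply: (@series_independent (fun t => f t - g t)) => [t|].
    by apply: (subspaceB (mulS_subspace _ _)) => //; apply: mulSS (hg t).
  by have := seriesB fx gx; rewrite subrr.
case: (hf s) => [->|[s0 sn hs]]; first by left.
apply: chainR_powR_degree s0 sn hs _; rewrite fg.
by apply: mulSS (hg s) => // y [].
Qed.
End Relations.

(** * The tensor algebra *)

Lemma scaler_mulr_span (k : fieldType) (L : lalgType k) (w : L) (J : Type)
    (r : seq J) (c : J -> k) (e : J -> L) :
  (forall j b, w * (b *: e j) = b *: (w * e j)) ->
  forall a, w * (a *: \sum_(j <- r) c j *: e j)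
            = a *: (w * \sum_(j <- r) c j *: e j).
Proof.
move=> h a; rewrite scaler_sumr !mulr_sumr scaler_sumr.
by apply: eq_bigr => j _; rewrite scalerA !h scalerA.
Qed.

Lemma commuting_scale_subspace (k : fieldType) (L : lalgType k) (a : k) (y : L) :
  is_subspace [set x | x * (a *: y) = a *: (x * y)].
Proof.
split=> /= [|b x x' hx hx']; first by rewrite !mul0r scaler0.
by rewrite !mulrDl -!scalerAl hx hx' scalerDr !scalerA mulrC.
Qed.

Section TensorAlgebraWords.
Context {k : fieldType} (V : vectType k).
Local Notation I := 'I_(\dim {:V}).
Local Notation A := {malg k[{fmonom I}]}.

Let wd (s : seq I) : TV V := << FMonom s >>.
Let cf (x : TV V) (s : seq I) : k := mcoeff (FMonom s : {fmonom I}) (x : A).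
Let lift (X : lmodType k) (g : seq I -> X) (x : TV V) : X :=
  \sum_(m <- msupp (x : A)) cf x m *: g m.

Let coef_linear s : linear ((cf^~ s) : TV V -> k^o).
Proof. by move=> a x y; rewrite /cf mcoeffD mcoeffZ. Qed.

Let cf_wd s t : cf (wd s) t = (s == t)%:R.
Proof. by rewrite /cf mcoeffU. Qed.

Let cf_inj x y : cf x =1 cf y -> x = y.
Proof. by move=> h; apply/malgP => -[s]; apply: h. Qed.

Let cf_finite x : exists n, forall s, (n <= size s)%N -> cf x s = 0.
Proof.
exists (\max_(m <- msupp (x : A)) size m).+1 => s ns; rewrite /cf mcoeff_outdom //.
apply: contraL ns => sx; rewrite -ltnNge ltnS.
exact: (@leq_bigmax_seq _ _ xpredT (fun m : {fmonom I} => size m) (FMonom s)).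
Qed.

Let wd_expand (x : TV V) : x = \sum_(m <- msupp (x : A)) cf x m *: wd m.
Proof.
apply: etrans (monalgE (x : A)) _; apply: eq_bigr => m _; apply/malgP => n.
by rewrite [RHS]mcoeffZ !mcoeffU /cf !fmK mulr_natr.
Qed.

Let wd_span : span (range wd) = setT.
Proof.
apply/seteqP; split=> // x _; rewrite [x]wd_expand.
apply: subspace_sum => [|m _]; first exact: span_subspace.
by apply: (subspaceZ (span_subspace _)); apply: sub_span; exists m.
Qed.

Let wd_nil : wd [::] = 1.
Proof. by rewrite /wd -[RHS]/(<< mone >>) -[mone]/(fmone _) fmoneE. Qed.

Let wd_cat : {morph wd : s t / s ++ t >-> s * t}.
Proof. by move=> s t; rewrite /wd [RHS]fgmulUU mulr1 [mmul _ _]fmmulE. Qed.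

Let wd_mulZ s c t : wd s * (c *: wd t) = c *: (wd s * wd t).
Proof.
have E d m : d *: wd m = << d *g FMonom m >>.
  by apply/malgP => n; rewrite [LHS]mcoeffZ !mcoeffU mulr_natr.
by rewrite -wd_cat !E /wd [LHS]fgmulUU mul1r [mmul _ _]fmmulE.
Qed.

Let mulZ (a : k) (x y : TV V) : x * (a *: y) = a *: (x * y).
Proof.
have : span (range wd) x by rewrite wd_span.
move: x; apply: span_min; first exact: commuting_scale_subspace.
move=> _ [s _ <-] /=.
by rewrite (wd_expand y); apply: scaler_mulr_span => m b; apply: wd_mulZ.
Qed.

Let liftEw (X : lmodType k) (g : seq I -> X) (d : {fset {fmonom I}}) (x : TV V) :
  (msupp (x : A) `<=` d)%fset -> lift g x = \sum_(m <- d) cf x m *: g m.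
Proof.
move=> xd; rewrite /lift (big_fset_incl _ xd) //= => p _ hp.
by rewrite /cf fmK mcoeff_outdom // scale0r.
Qed.

Let lift_linear (X : lmodType k) (g : seq I -> X) : linear (lift g).
Proof.
move=> a x y; pose z := a *: x + y; rewrite -/z.
pose sp w := msupp (w : A).
pose d := (sp x `|` sp y `|` sp z)%fset.
rewrite !(@liftEw _ _ d) /d; first last.
- exact: fsubsetUr.
- by rewrite -fsetUA fsubsetUl.
- by rewrite fsetUAC fsubsetUr.
rewrite scaler_sumr -big_split; apply: eq_bigr => p _ /=.
have /= -> := coef_linear p a x y; by rewrite scalerDl scalerA.
Qed.

Let lift_wd (X : lmodType k) (g : seq I -> X) s : lift g (wd s) = g s.
Proof.
rewrite (@liftEw _ _ [fset FMonom s]%fset); last exact: (msuppU_le (x := 1)).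
by rewrite big_seq_fset1 cf_wd eqxx scale1r.
Qed.

Lemma TV_words_subproof : {F : free_words I (TV V) |
  forall v, inV v = \sum_i coord (vbasis {:V}) i v *: fw_word F [:: i]}.
Proof.
exists (FreeWords coef_linear cf_wd cf_inj cf_finite wd_span wd_nil wd_cat mulZ
  lift_linear lift_wd) => v.
rewrite /inV; apply: eq_bigr => i _; apply/malgP => n.
by rewrite [RHS]mcoeffZ /= /wd !mcoeffU fmuE mulr_natr.
Qed.

Definition TV_words := sval TV_words_subproof.

Lemma inV_words v :
  inV v = \sum_i coord (vbasis {:V}) i v *: fw_word TV_words [:: i].
Proof. exact: (svalP TV_words_subproof). Qed.

End TensorAlgebraWords.

Section TensorAlgebraSpaces.
Context {k : fieldType} {V : vectType k}.
Local Notation T := (TV V).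
Local Notation F := (TV_words V).

Lemma inV_basis (i : 'I_(\dim {:V})) : inV (vbasis {:V})`_i = fw_word F [:: i].
Proof.
have free_basis := basis_free (vbasisP {:V}).
rewrite inV_words (bigD1 i) //= coord_free // eqxx scale1r.
rewrite big1 ?addr0 // => j /negPf ji.
by rewrite coord_free // eq_sym ji scale0r.
Qed.

Lemma genE : (gen : set T) = hom F 1.
Proof.
apply/seteqP; split=> [_ [v _ <-]|x hx].
  rewrite inV_words; apply: subspace_sum => [|i _]; first exact: hom_subspace.
  by apply: (subspaceZ (hom_subspace F 1)); apply: (@hom_wd _ _ _ F [:: i]).
exists (\sum_(i : 'I_(\dim {:V})) fw_coef F x [:: i] *: (vbasis {:V})`_i) => //.
rewrite (lin_sum inV_linear) [RHS](hom_expand hx).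
transitivity (\sum_(i : 'I_(\dim {:V})) fw_coef F x [:: i] *: fw_word F [:: i]).
  by apply: eq_bigr => i _; rewrite (linZ inV_linear) inV_basis.
pose h (i : 'I_(\dim {:V})) : 1.-tuple 'I_(\dim {:V}) := [tuple i].
rewrite [RHS](reindex h) //=; exists (fun u => thead u) => [i _|u _] /=.
  by [].
by case/tupleP: u => a t; rewrite (tuple0 t); apply: val_inj; rewrite /= theadE.
Qed.

Lemma VpowE n : Vpow n = hom F n :> set T.
Proof.
elim: n => [|n IHn]; first exact: (oneSE F).
rewrite -add1n -(prod_hom F) -IHn -genE //.
Qed.

Lemma Vpow_hom : Vpow = hom F :> (nat -> set T).
Proof. by apply/funext => n; apply: VpowE. Qed.

Lemma gen_Vpow : gen = Vpow 1 :> set T.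
Proof. by rewrite VpowE genE. Qed.

Lemma Vpow_subspace n : is_subspace (Vpow n : set T).
Proof. by rewrite VpowE; apply: hom_subspace. Qed.

Lemma prodS_unit (W : set T) : is_subspace W -> prodS W unitS = W.
Proof. exact: (mulS1 F). Qed.

Lemma unit_prodS (W : set T) : is_subspace W -> prodS unitS W = W.
Proof. exact: mul1S. Qed.

Lemma prodSA (W1 W2 W3 : set T) :
  prodS W1 (prodS W2 W3) = prodS (prodS W1 W2) W3.
Proof. exact: (mulSA F). Qed.
End TensorAlgebraSpaces.

(** * The spaces of the two complexes *)

Section Spaces.
Context {k : fieldType} {V : vectType k} (S : set nat) (R : set (TV V)).
Local Notation T := (TV V).
Local Notation F := (TV_words V).
Local Notation chain := (chainR F R).
Local Notation proj := (proj F).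
Local Notation mid := (mid F).
Local Notation "W1 ** W2" := (prodS W1 W2) (at level 40, left associativity).
Hypothesis hR : graded_relations S R.
Implicit Types (x y : T) (s n i N l : nat).

Lemma R_subspace : is_subspace R.
Proof. by case: (rel_space hR). Qed.

Lemma S_ge2 s : S s -> (2 <= s)%N.
Proof. exact: rel_degree hR s. Qed.

Lemma R_proj n x : R x -> R (proj n x).
Proof.
rewrite {1}(rel_graded hR); move: x.
apply: (@span_min _ _ _ [set x | R (proj n x)]).
  exact: (subspace_preim (proj_linear F n) R_subspace).
move=> x [s _ [Rx]]; rewrite VpowE /= => hx.
have [->|ns] := eqVneq n s; first by rewrite hom_proj.
by rewrite (proj_other hx ns); apply: subspace0 R_subspace.
Qed.

Lemma from_Tpos : from F 1 `<=` Tpos.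
Proof.
move=> x hx; have [n h] := proj_series F x; rewrite (h n) //.
apply: subspace_sum => [|i _]; first exact: span_subspace.
have [i0|i0] := posnP i.
  by rewrite (proj_from hx) ?i0 //; apply: subspace0 (span_subspace _).
apply: sub_span; exists (nat_of_ord i) => //.
by rewrite VpowE; apply: proj_hom.
Qed.

Lemma R_minl x : R x -> (mulS (mulS (from F 1) R) setT) x -> x = 0.
Proof.
move=> Rx hx; have [_ /seteqP[+ _]] := rel_space hR; apply.
split=> //; exists x.
  by move: hx; apply: mulSS => //; apply: mulSS => //; apply: from_Tpos.
by exists 0; [apply: subspace0 (span_subspace _)|rewrite addr0].
Qed.

Lemma R_minr x : R x -> (mulS R (from F 1)) x -> x = 0.
Proof.
move=> Rx hx; have [_ /seteqP[+ _]] := rel_space hR; apply.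
split=> //; exists 0; first exact: subspace0 (span_subspace _).
exists x; last by rewrite add0r.
move: hx; apply: mulSS => [y Ry|]; last exact: from_Tpos.
by rewrite -[y]mul1r; apply: mulS_mul.
Qed.

Lemma chain_subspace s n : is_subspace (chain s n).
Proof. exact: chainR_subspace R_subspace s n. Qed.

(** Both the intersection over positions and the condition on subwords are read
    off from the stripped elements; i = 0, 1 agree as no word of length i < s has
    a subword of length s. *)
Lemma HR_JsE s i : (2 <= s)%N -> HR_Js R s i = chain s (hr_deg s i).
Proof.
move=> s2; rewrite /HR_Js.
have Rs_sub : is_subspace (R `&` hom F s).
  by apply: subspaceI; [apply: R_subspace|apply: hom_subspace].
case: ifP => i2.
  have -> : hr_deg s i = i by case: i i2 => [|[|]] //=; rewrite /hr_deg muln0.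
  by rewrite chainR_small ?VpowE // (leq_trans i2).
have sd : (s <= hr_deg s i)%N.
  rewrite /hr_deg; have : (0 < i./2)%N by lia.
  by case: (i./2) => // j _; rewrite mulnS -addnA leq_addr.
rewrite /homog Vpow_hom; apply/seteqP; split=> x /=.
  move=> h; have mids l : (l <= hr_deg s i - s)%N -> from F (hr_deg s i - s)%N x /\
      forall u v, size u = l -> size v = (hr_deg s i - s - l)%N ->
      (R `&` hom F s) (mid u v x).
    move=> le; have := h l le => /(sandwichP F _ _ Rs_sub).
    by rewrite subnKC.
  split.
    have : mulS (mulS (hom F 0) (hom F s)) (hom F (hr_deg s i - s)%N) x.
      have := h 0%N isT; rewrite subn0.
      by apply: mulSS => //; apply: mulSS => // y [].
    by rewrite !prod_hom add0n subnKC.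
  move=> u v E; have [|_ h'] := mids (size u); first by lia.
  have vr : size v = (hr_deg s i - s - size u)%N by lia.
  by have [] := h' u v erefl vr.
move=> hx l le; apply/(sandwichP F _ _ Rs_sub); split.
  by apply: hom_from (chainR_hom hx) _; lia.
move=> u v ul vr; split.
  by apply: hx.2; lia.
by apply: mid_hom; apply: (_ : hom F _ x); rewrite (_ : (_ + _ + _)%N = hr_deg s i);
  [apply: chainR_hom hx|lia].
Qed.

(** The sum over s in S of the spaces chain s (c s), for c injective on S
    ([chain_sumE]), in terms of homogeneous parts. *)
Definition chain_sum (c : nat -> nat) : set T := [set x | forall n,
  (forall s, S s -> n = c s -> chain s n (proj n x)) /\
  ((forall s, S s -> n <> c s) -> proj n x = 0)].

Lemma chain_sum_subspace c : is_subspace (chain_sum c).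
Proof.
split=> [n|a x y hx hy n]; split.
- by move=> *; rewrite (lin0 (proj_linear F n)); apply: subspace0 (chain_subspace _ _).
- by rewrite (lin0 (proj_linear F n)).
- move=> s Ss E; rewrite (proj_linear F n); apply: (chain_subspace _ _).2.
    exact: (hx n).1.
  exact: (hy n).1.
- by move=> h; rewrite (proj_linear F n) (hx n).2 // (hy n).2 // scaler0 addr0.
Qed.

Lemma chain_in_sum c s x : (forall s s', S s -> S s' -> c s = c s' -> s = s') ->
  S s -> chain s (c s) x -> chain_sum c x.
Proof.
move=> cI Ss hx n; split=> [s' Ss' E|h].
  have [Ec|ne] := eqVneq n (c s).
    have <- : s = s' by apply: cI => //; rewrite -Ec.
    by rewrite Ec hom_proj //; apply: chainR_hom hx.
  by rewrite (proj_other (chainR_hom hx) ne); apply: subspace0 (chain_subspace _ _).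
by apply: (proj_other (chainR_hom hx)); apply/eqP; apply: h.
Qed.

Lemma chain_sumE c : (forall s s', S s -> S s' -> c s = c s' -> s = s') ->
  sumS S (fun s => chain s (c s)) = chain_sum c.
Proof.
move=> cI; apply/seteqP; split.
  apply: span_min; first exact: chain_sum_subspace.
  by move=> x [s Ss]; apply: chain_in_sum.
move=> x hx; have [n h] := proj_series F x; rewrite (h n) //.
apply: subspace_sum => [|i _]; first exact: span_subspace.
have [[s [Ss E]]|no] := pselect (exists s, S s /\ (i : nat) = c s).
  by apply: sub_span; exists s => //; rewrite -E; apply: (hx i).1.
rewrite (hx i).2; first exact: subspace0 (span_subspace _).
by move=> s Ss E; apply: no; exists s.
Qed.

Lemma hr_deg_inj i s s' : (2 <= i)%N -> hr_deg s i = hr_deg s' i -> s = s'.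
Proof.
rewrite /hr_deg => i2 /addIn/eqP; rewrite eqn_mul2r => /orP[|/eqP//]; lia.
Qed.

Lemma hr_deg_ge s i : (2 <= i)%N -> (s <= hr_deg s i)%N.
Proof.
rewrite /hr_deg => i2; have : (0 < i./2)%N by lia.
by case: (i./2) => // j _; rewrite mulnS -addnA leq_addr.
Qed.

Lemma HR_JE i : (2 <= i)%N -> HR_J S R i = chain_sum (hr_deg^~ i).
Proof.
move=> i2; rewrite -chain_sumE => [|s s' _ _]; last exact: hr_deg_inj.
rewrite /HR_J ltnNge i2 /= /sumS; congr (span _); apply: eq_bigcupr => s Ss.
by rewrite HR_JsE //; apply: S_ge2.
Qed.

Lemma chain_HR_J s i : S s -> chain s (hr_deg s i) `<=` HR_J S R i.
Proof.
move=> Ss x; have s2 := S_ge2 Ss; rewrite -HR_JsE // /HR_J /HR_Js.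
by case: ifP => // i2 hx; apply: sub_span; exists s => //; rewrite i2.
Qed.

Lemma HR_J_subspace i : is_subspace (HR_J S R i).
Proof.
rewrite /HR_J; case: ifP => _; last exact: span_subspace.
by rewrite VpowE; apply: hom_subspace.
Qed.

(** For W = HR_J S R i the intersection of the spaces V^(l) W V^(N - l) is the
    sum of the spaces that consist, in length hr_deg s i + N, of the elements
    all of whose subwords of length s are relations: every such subword lies in
    the middle factor for a suitable l. *)
Lemma sandwich_HR_J i N x : (2 <= i)%N ->
  (forall l, (l <= N)%N -> (Vpow l ** HR_J S R i ** Vpow (N - l)) x) <->
  chain_sum (fun s => hr_deg s i + N)%N x.
Proof.
move=> i2; have hJ := HR_J_subspace i; split.
  move=> h.
  have {h} h l : (l <= N)%N -> from F N x /\ forall u v,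
      size u = l -> size v = (N - l)%N -> HR_J S R i (mid u v x).
    by move=> le; have := h l le; rewrite !VpowE => /(sandwichP F _ _ hJ); rewrite subnKC.
  have [xN _] := h 0%N isT; move=> n; split=> [s Ss En|ne].
    split; first exact: proj_hom.
    move=> u v E; have sd := hr_deg_ge s i2.
    (* the subword after u lies in the factor W that starts after l letters *)
    pose l := minn (size u) N; have lu : (l <= size u)%N by apply: geq_minl.
    have lN : (l <= N)%N by apply: geq_minr.
    have vN : (N - l <= size v)%N by rewrite /l; lia.
    pose u1 := take l u; pose u2 := drop l u.
    pose v2 := take (size v - (N - l)) v; pose v1 := drop (size v - (N - l)) v.
    have u1l : size u1 = l by rewrite size_takel.
    have v1l : size v1 = (N - l)%N by rewrite size_drop subKn.
    have -> : mid u v (proj n x) = mid u2 v2 (proj (hr_deg s i) (mid u1 v1 x)).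
      rewrite -mid_proj mid_mid !cat_take_drop u1l v1l.
      by congr (mid _ _ (proj _ _)); lia.
    have := h l lN => -[_ /(_ u1 v1 u1l v1l)]; rewrite HR_JE // => /(_ (hr_deg s i)).
    move=> [/(_ s Ss erefl) [_ +] _]; apply.
    by rewrite /u2 /v2 size_drop size_takel ?leq_subr //; lia.
  have [nN|Nn] := ltnP n N; first by rewrite (proj_from xN nN).
  apply: (@strip_eq0r _ _ _ F N).
    by apply: hom_from Nn; apply: proj_hom.
  move=> v vN.
  have En : n = (size (Nil 'I_(\dim {:V})) + (n - N) + size v)%N by rewrite vN add0n subnK.
  rewrite {1}En mid_proj.
  have [_ /(_ [::] v erefl)] := h 0%N isT; rewrite subn0 => /(_ vN).
  rewrite HR_JE // => /(_ (n - N)%N)[_]; apply=> s Ss E.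
  by apply: (ne s Ss); rewrite -E subnK.
move=> h l le; rewrite !VpowE; apply/(sandwichP F _ _ hJ); rewrite subnKC //.
split=> [w wN|u v ul vl].
  have [_ /(_ _)E] := h (size w).
  have /E/(congr1 (fun z => fw_coef F z w)) : forall s, S s -> size w <> (hr_deg s i + N)%N.
    by move=> s _ Ew; lia.
  by rewrite cf_proj eqxx cf0.
rewrite HR_JE // => n; rewrite -mid_proj ul vl.
have -> : (l + n + (N - l) = n + N)%N by lia.
split=> [s Ss En|ne].
  apply: chainR_mid; rewrite ul vl (_ : (l + n + (N - l) = n + N)%N); last by lia.
  by apply: (h (n + N)%N).1; rewrite ?En.
rewrite (h (n + N)%N).2 ?(lin0 (mid_linear F _ _)) // => s Ss /addIn; exact: ne.
Qed.

End Spaces.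

Section Coincidence.
Context {k : fieldType} {V : vectType k} (S : set nat) (R : set (TV V)).
Local Notation T := (TV V).
Local Notation F := (TV_words V).
Local Notation chain := (chainR F R).
Local Notation proj := (proj F).
Local Notation mid := (mid F).
Local Notation "W1 ** W2" := (prodS W1 W2) (at level 40, left associativity).
Hypothesis hR : graded_relations S R.
Implicit Types (x y : T) (s n i N l : nat).

Let RJ := R_subspace hR.

Lemma hr_deg_double s i : hr_deg s i.*2 = (s * i)%N.
Proof. by rewrite /hr_deg doubleK odd_double addn0. Qed.

Lemma hr_deg_doubleS s i : hr_deg s i.*2.+1 = (s * i + 1)%N.
Proof. by rewrite /hr_deg /= odd_double uphalf_double. Qed.

(** Cut the element into pieces of lengths m_1, s n_1, m_2, s n_2, and so on. *)
Lemma alternating_chain (Jev : nat -> set T) s (t : seq (nat * nat)) z :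
  (forall p, p \in t -> chain s (s * p.2)%N `<=` Jev p.2) ->
  chain s (sumn [seq (p.1 + s * p.2)%N | p <- t] + z)%N `<=`
  foldr (fun mn W => Vpow mn.1 ** (Jev mn.2 ** W)) (Vpow z) t.
Proof.
elim: t => [|[m n] t IHt] h /=.
  by rewrite add0n VpowE; apply: chainR_hom.
rewrite -!addnA => x /(chainR_cat RJ)/=; apply: mulSS => [y /chainR_hom|y].
  by rewrite VpowE.
move=> /(chainR_cat RJ); apply: mulSS; first by apply: (h (m, n)); apply: mem_head.
by apply: IHt => p pt; apply: h; rewrite in_cons pt orbT.
Qed.

Lemma sumn_zip s (m n : seq nat) z : size n = size m ->
  (sumn [seq (p.1 + s * p.2)%N | p <- zip (rcons m z) n] + z =
   sumn (rcons m z) + s * sumn n)%N.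
Proof.
elim: m n => [|a m IHm] [|b n] //= => [_|[mn]]; first by rewrite muln0 !addn0.
by rewrite -addnA IHm // mulnDr; lia.
Qed.

(** The factor of index (n, m) = ((i+1, 0, ..., 0), (l, N - l, 0, ..., 0)) is the
    only one needed for the inclusion of J_(2(i+2)) in the space of Herscovich
    and Rey. *)
Lemma alternating_two (Jev : nat -> set T) i N l x : Jev 0%N = unitS ->
  (forall (n : i.+1.-tuple nat) (m : i.+2.-tuple nat), sumn n = i.+1 ->
     sumn m = N -> alternating_prod Jev m n x) ->
  (l <= N)%N -> (Vpow l ** Jev i.+1 ** Vpow (N - l)) x.
Proof.
move=> J0 h lN.
have s0 : sumn (nseq i 0%N) = 0%N by rewrite sumn_nseq mul0n.
have := h [tuple of i.+1 :: nseq i 0%N] [tuple of l :: (N - l)%N :: nseq i 0%N].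
move=> /(_ _ _); rewrite /= s0 !addn0 subnKC // => /(_ erefl erefl).
rewrite /alternating_prod (tnth_nth 0%N) /=.
have tail a : foldr (fun mn W => Vpow mn.1 ** (Jev mn.2 ** W))
    (Vpow (nth 0%N (a :: nseq i 0%N) i)) (zip (a :: nseq i 0%N) (nseq i 0%N)) = Vpow a.
  elim: i {h s0} a => [|i IHi] a //=.
  by rewrite IHi J0 unit_prodS ?prodS_unit //; apply: Vpow_subspace.
by rewrite tail prodSA.
Qed.

(** In length n the summand of index N contributes through at most one s, the
    one with n = s (i+1) + N; so the components may be indexed by s. *)
Lemma even_step_series i x n :
  (forall m, (m <= i.+1)%N -> J R m.*2 = HR_J S R m.*2) ->
  J_even_step R (fun m => J R m.*2) i.+1 x ->
  exists2 g, series g (proj n x) & forall s,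
    (S s -> (s <= n)%N -> chain s n (g s)) /\ (~ (S s /\ (s <= n)%N) -> g s = 0).
Proof.
move=> IH [+ _]; move: x; apply: span_min.
  split=> [|a x y [f fx hf] [g gy hg]].
    exists (fun=> 0); first by exists 0%N => m _; rewrite big1 ?(lin0 (proj_linear F n)).
    by move=> s; split=> // *; apply: subspace0 (chain_subspace hR _ _).
  exists (fun s => a *: f s + g s); first by rewrite (proj_linear F n); apply: series_lin.
  move=> s; split=> [Ss sn|no].
    by apply: (chain_subspace hR _ _).2; [apply: (hf s).1|apply: (hg s).1].
  by rewrite (hf s).2 // (hg s).2 // scaler0 addr0.
move=> x [N N0 h].
have [] := @sandwich_HR_J _ _ _ _ hR i.+1.*2 N x; first by rewrite doubleS.
move=> /(_ _)hx _; have {hx}/(_ n)[hx1 hx2] : chain_sum S R (fun s => hr_deg s i.+1.*2 + N)%N x.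
  apply: hx => l lN; rewrite -IH //.
  exact: (alternating_two (Jev := fun m => J R m.*2)) h lN.
have [[s [Ss En]]|no] := pselect (exists s, S s /\ n = (hr_deg s i.+1.*2 + N)%N).
  exists (fun t => if t == s then proj n x else 0); first exact: series_single.
  have sn : (s <= n)%N by rewrite En hr_deg_double mulnS -addnA leq_addr.
  move=> t; case: eqP => [->|_]; split=> //.
  - by move=> _ _; apply: hx1.
  - by case.
  - by move=> *; apply: subspace0 (chain_subspace hR _ _).
exists (fun=> 0).
  rewrite hx2; first by exists 0%N => m _; rewrite big1.
  by move=> s Ss En; apply: no; exists s.
by move=> s; split=> // *; apply: subspace0 (chain_subspace hR _ _).
Qed.

(** In the direct inclusion R^(i+2) selects the component with n = s (i+2); for
    the converse an element of chain s (s (i+2)) belongs to the summand N = s. *)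
Lemma J_even_stepE i :
  (forall m, (m <= i.+1)%N -> J R m.*2 = HR_J S R m.*2) ->
  J_even_step R (fun m => J R m.*2) i.+1 = HR_J S R i.+2.*2.
Proof.
move=> IH; apply/seteqP; split=> x.
  move=> hx; rewrite (HR_JE hR) // => n.
  have [g gx hg] := even_step_series n IH hx.
  have xR : powR R i.+2 (proj n x) by apply: (powR_proj (R_proj hR)); case: hx.
  have gs : forall s, g s = 0 \/ n = (s * i.+2)%N.
    apply: (powR_chainR_series RJ (R_proj hR) (R_minl hR) (R_minr hR) gx xR (n := n)).
    move=> s; have [[Ss sn]|no] := pselect (S s /\ (s <= n)%N); last by left; apply: (hg s).2.
    by right; split=> //; [have := S_ge2 hR Ss; lia|apply: (hg s).1].
  have [m hm] := gx; rewrite (hm m) //; split=> [s Ss En|ne].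
    apply: subspace_sum => [|t _]; first exact: (chain_subspace hR).
    case: (gs t) => [->|En']; first exact: subspace0 (chain_subspace hR _ _).
    have E : (t : nat) = s by apply: (@hr_deg_inj i.+2.*2) => //; rewrite -En hr_deg_double.
    rewrite E; apply: (hg s).1 => //.
    by rewrite En hr_deg_double mulnS leq_addr.
  rewrite big1 // => t _; case: (gs t) => // En.
  by apply: (hg t).2 => -[St _]; apply: (ne t St); rewrite hr_deg_double.
have sub : is_subspace (J_even_step R (fun m => J R m.*2) i.+1).
  by apply: subspaceI; [apply: span_subspace|exact: (powR_subspace R i.+2)].
rewrite (HR_JE hR) // -(chain_sumE hR); last first.
  by move=> s s' _ _; apply: hr_deg_inj.
move: x; apply: span_min => // x [s Ss].
have s2 := S_ge2 hR Ss; rewrite hr_deg_double => hx; split; last first.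
  by apply: (chainR_powR RJ) hx; lia.
apply: sub_span; exists s; first by rewrite /=; lia.
move=> n m ni mN; rewrite /alternating_prod.
have [m' [z Em]] : exists m' z, tval m = rcons m' z.
  by case/lastP: (tval m) (size_tuple m) => // m' z _; exists m', z.
have sm' : size n = size m'.
  by have := congr1 size Em; rewrite !size_tuple size_rcons => -[].
have Ez : tnth m ord_max = z.
  by rewrite (tnth_nth 0%N) /= Em nth_rcons -sm' size_tuple ltnn eqxx.
rewrite Ez Em; apply: (@alternating_chain (fun m => J R m.*2) s).
  move=> [a c] /= /(map_f snd); rewrite -/unzip2 unzip2_zip /=; last first.
    by rewrite size_rcons sm'.
  move=> cn; have ci : (c <= i.+1)%N.
    by rewrite -ni; move: cn => /perm_to_rem/perm_sumn ->; rewrite leq_addr.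
  by rewrite IH // -hr_deg_double; apply: (chain_HR_J hR).
by rewrite sumn_zip // -Em ni mN -mulnS.
Qed.

Lemma J_even_HR_J i : J R i.*2 = HR_J S R i.*2.
Proof.
elim/ltn_ind: i => -[|[|i]] IH //.
  rewrite -[J R _]/R /HR_J /= {1}(rel_graded hR) /sumS; congr (span _).
  apply: eq_bigcupr => s Ss; rewrite (HR_JsE hR) ?(S_ge2 hR) //.
  rewrite (hr_deg_double s 1) muln1 /homog Vpow_hom.
  by apply/seteqP; split=> x /(chainR_self F R).
rewrite J_evenS //; apply: J_even_stepE => m mi; exact: IH.
Qed.

(** In odd degrees, V J and J V form the case N = 1 of [sandwich_HR_J]. *)
Lemma J_HR_J i : J R i = HR_J S R i.
Proof.
rewrite -(odd_double_half i); case: (odd i); last exact: J_even_HR_J.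
rewrite add1n J_odd J_even_HR_J; case: i./2 => [|j].
  rewrite -[HR_J S R 0.*2]/unitS -[HR_J S R 0.*2.+1]/(Vpow 1).
  by rewrite gen_Vpow prodS_unit ?unit_prodS ?setIid //; apply: Vpow_subspace.
have hJ := HR_J_subspace S R j.+1.*2.
have -> : HR_J S R j.+1.*2.+1 = chain_sum S R (fun s => hr_deg s j.+1.*2 + 1)%N.
  rewrite (HR_JE hR) //; congr (chain_sum _ _ _); apply/funext => s.
  by rewrite hr_deg_double hr_deg_doubleS.
rewrite gen_Vpow; apply/seteqP; split=> x.
  move=> [hl hr]; apply/(sandwich_HR_J hR) => // -[|[|//]] _.
    by rewrite subn0 [prodS (Vpow 0) _]unit_prodS.
  by rewrite subnn [prodS _ (Vpow 0)]prodS_unit //; apply: mulS_subspace.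
move=> /(sandwich_HR_J hR)h; have {}h l := h isT l.
split; last by have := h 0%N isT; rewrite subn0 [prodS (Vpow 0) _]unit_prodS.
have := h 1%N isT; rewrite subnn [prodS _ (Vpow 0)]prodS_unit //.
exact: mulS_subspace.
Qed.
End Coincidence.

(** * The components in the even differential *)

Section Components.
Context {k : fieldType} {V : vectType k} (S : set nat) (R : set (TV V)).
Local Notation T := (TV V).
Local Notation F := (TV_words V).
Local Notation chain := (chainR F R).
Local Notation proj := (proj F).
Hypothesis hR : graded_relations S R.
Implicit Types (x y w : T) (s n i j N l d : nat).

Lemma J_cap1 N : J_cap R 1 N = hom F N.+1.
Proof.
have J1 : J R 1 = Vpow 1 by rewrite (J_HR_J hR).
rewrite /J_cap /= J1 !Vpow_hom; apply/seteqP; split=> x /=.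
  move=> /(_ 0%N isT); rewrite subn0 => hx.
  have : mulS (mulS (hom F 0) (hom F 1)) (hom F N) x by [].
  by rewrite !prod_hom add0n add1n.
move=> hx l lN; change (mulS (mulS (hom F l) (hom F 1)) (hom F (N - l)%N) x).
by rewrite !prod_hom addn1 addSn subnKC.
Qed.

Lemma J_capSS j N : J_cap R j.+2 N = chain_sum S R (fun s => s * j.+1 + N.+1)%N.
Proof.
have -> : (fun s => s * j.+1 + N.+1)%N = (fun s => hr_deg s j.+1.*2.+1 + N)%N.
  by apply/funext => s; rewrite hr_deg_doubleS -addnA add1n.
apply/seteqP; split=> x; rewrite /J_cap /= (J_HR_J hR).
  by move=> h; apply/(sandwich_HR_J hR).
by move=> /(sandwich_HR_J hR); apply.
Qed.

(** In length (N+1) j only s = N+1 contributes to J_(2j), and chain s (s j) lies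
    in J_cap j (s-1). *)
Lemma J_cap_proj j N w : J R j.+1.*2 w -> J_cap R j.+1 N (proj (N.+1 * j.+1)%N w).
Proof.
case: j => [|j] hw; first by rewrite J_cap1 muln1; apply: proj_hom.
rewrite J_capSS; move: hw; rewrite (J_HR_J hR) (HR_JE hR) // => hw.
have [hw1 hw2] := hw (N.+1 * j.+2)%N.
have E : (N.+1 * j.+2 = N.+1 * j.+1 + N.+1)%N by rewrite [in LHS]mulnS addnC.
have [SN|no] := pselect (S N.+1); last first.
  rewrite hw2; first exact: (subspace0 (chain_sum_subspace hR _)).
  move=> s Ss; rewrite hr_deg_double => /eqP; rewrite eqn_pmul2r // => /eqP Es.
  by apply: no; rewrite Es.
apply: (@chain_in_sum _ _ _ _ hR _ N.+1) => //.
  by move=> s s' _ _ /addIn/eqP; rewrite eqn_pmul2r // => /eqP.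
by rewrite -E; apply: hw1 => //; rewrite hr_deg_double.
Qed.

Lemma J_series j w : J R j.+1.*2 w -> series (fun N => proj (N.+1 * j.+1)%N w) w.
Proof.
rewrite (J_HR_J hR) (HR_JE hR) // -(chain_sumE hR) => [|s s' _ _]; last exact: hr_deg_inj.
move: w; apply: span_min.
  split=> [|a x y hx hy].
    by exists 0%N => m _; rewrite big1 // => N _; rewrite (lin0 (proj_linear F _)).
  have := series_lin a hx hy; congr series; apply/funext => N.
  by rewrite proj_linear.
move=> x [s Ss hx]; have := series_single s.-1 x; congr series; apply/funext => N.
have s2 := S_ge2 hR Ss; have := chainR_hom hx; rewrite hr_deg_double => xh.
have [->|ne] := eqVneq; first by rewrite prednK ?hom_proj //; lia.
rewrite (proj_other xh) // eqn_pmul2r //; apply: contraNneq ne => <- //.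
Qed.

(** In length d the space J_cap j N is in R_s T with d = s (j-1) + N + 1, and
    different N give different s; so the spaces J_cap j N are independent, and
    the homogeneous parts of w are its only components.  For j = 1, where
    J_(2j-1) = V contains no relations, the lengths alone separate them. *)
Lemma J_cap_unique j n (wN : nat -> T) w : J R j.+1.*2 w ->
  w = \sum_(N < n) wN N -> (forall N, (N < n)%N -> J_cap R j.+1 N (wN N)) ->
  forall N, (N < n)%N -> wN N = proj (N.+1 * j.+1)%N w.
Proof.
case: j => [|j] hw sumw capN N Nn.
  have hN i : (i < n)%N -> hom F i.+1 (wN i) by rewrite -J_cap1; apply: capN.
  rewrite muln1 sumw (lin_sum (proj_linear F _)) (bigD1 (Ordinal Nn)) //=.
  rewrite hom_proj; last exact: hN.
  rewrite big1 ?addr0 // => i ne; rewrite (proj_other (hN i (ltn_ord i))) //.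
  by rewrite eqSS eq_sym.
apply/eqP; rewrite -subr_eq0; apply/eqP; apply: (proj_eq0 (F := F)) => d.
(* n + d summands suffice for both families: (i+1) (j+2) = d forces i < d *)
pose g i := if (i < n)%N then proj d (wN i) else 0.
pose h i := if d == (i.+1 * j.+2)%N then proj d w else 0.
have sumg : \sum_(i < n + d) g i = proj d w.
  rewrite (sum_ord_bounded (n := n)) ?leq_addr //; last first.
    by move=> i; rewrite /g ltnNge => ->.
  rewrite [in RHS]sumw (lin_sum (proj_linear F d)).
  by apply: eq_bigr => i _; rewrite /g ltn_ord.
move: (hw); rewrite (J_HR_J hR) (HR_JE hR) // => /(_ d)[w1 w2].
have sumh : \sum_(i < n + d) h i = proj d w.
  have [[i di]|no] := pselect (exists i, d = (i.+1 * j.+2)%N).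
    have id : (i < n + d)%N by rewrite ltn_addl // di mulnS leq_addr.
    rewrite (bigD1 (Ordinal id)) //= /h -di eqxx big1 ?addr0 // => i' ne.
    case: eqP => // di'; case/eqP: ne; apply: val_inj.
    have /eqP : (i'.+1 * j.+2 = i.+1 * j.+2)%N by rewrite -di'.
    by rewrite eqn_pmul2r // eqSS => /eqP.
  rewrite big1 => [|i _].
    rewrite w2 // => s Ss; rewrite hr_deg_double => E; apply: no.
    by exists s.-1; rewrite prednK // ltnW // (S_ge2 hR).
  by rewrite /h; case: eqP => // E; case: no; exists i.
have degree i : g i - h i != 0 ->
    exists s, [/\ S s, d = (s * j.+1 + i.+1)%N & chain s d (g i - h i)].
  have [[s [Ss Ed]] _|no] := pselect (exists s, S s /\ d = (s * j.+1 + i.+1)%N).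
    exists s; split=> //; apply: (subspaceB (chain_subspace hR s d)); rewrite /g /h.
      case: ifP => [lt|_]; last exact: subspace0 (chain_subspace hR _ _).
      by move: (capN i lt); rewrite J_capSS => /(_ d)[hs _]; apply: hs.
    case: eqP => [Ed'|_]; last exact: subspace0 (chain_subspace hR _ _).
    apply: w1 => //; rewrite hr_deg_double Ed'; congr (_ * _)%N.
    have /eqP : (i.+1 * j.+1 + i.+1 = s * j.+1 + i.+1)%N.
      by rewrite -Ed Ed' [in RHS]mulnS addnC.
    by rewrite eqn_add2r eqn_pmul2r // => /eqP.
  have -> : g i = 0.
    rewrite /g; case: ifP => // lt; move: (capN i lt); rewrite J_capSS.
    by move=> /(_ d)[_ ->] // s Ss E; apply: no; exists s.
  have -> : h i = 0; last by rewrite subr0 eqxx.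
  rewrite /h; case: eqP => // Ed; apply: w2 => s Ss; rewrite hr_deg_double => E.
  have Es : s = i.+1 by move/eqP: E; rewrite Ed eqn_pmul2r // => /eqP.
  by apply: no; exists s; rewrite Ed [in LHS]mulnS addnC -Es.
have sgE i s : d = (s * j.+1 + i.+1)%N -> ((d - i.+1) %/ j.+1)%N = s.
  by move=> ->; rewrite addnK mulnK.
have all0 (q : 'I_(n + d)) : g q - h q = 0.
  apply: (@Rs_independent _ _ _ F R (R_subspace hR) (R_minr hR) (n + d)%N
    (fun q : 'I__ => g q - h q) (fun q : 'I__ => (d - q.+1) %/ j.+1)%N).
  - move=> p /degree[s [Ss Ed hc]]; rewrite (sgE _ _ Ed).
    apply: (chainR_Rs (R_subspace hR) _ hc).
    by rewrite Ed mulnS -addnA leq_addr.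
  - move=> p p' /degree[s [_ Ed _]] /degree[s' [_ Ed' _]].
    rewrite (sgE _ _ Ed) (sgE _ _ Ed') => ss'; apply: val_inj => /=.
    have /eqP : (s * j.+1 + p.+1 = s * j.+1 + p'.+1)%N by rewrite -Ed ss' -Ed'.
    by rewrite eqn_add2l eqSS => /eqP.
  - by rewrite sumrB sumg sumh subrr.
have Nnd : (N < n + d)%N by rewrite ltn_addr.
rewrite (linB (proj_linear F d)) -[RHS](all0 (Ordinal Nnd)) /= /g Nn.
congr (_ - _); rewrite /h; case: eqP => [->|/eqP ne].
  by rewrite hom_proj //; apply: proj_hom.
by rewrite (proj_other _ ne) //; apply: proj_hom.
Qed.
End Components.

(** * Linear maps on tensor products *)

Section LinearMaps.
Context {k : fieldType} {U W : lmodType k}.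

Lemma linear_comp (Y : lmodType k) (f : U -> W) (g : W -> Y) :
  linear f -> linear g -> linear (fun x => g (f x)).
Proof. by move=> hf hg a x y; rewrite hf hg. Qed.

Lemma linear_scale (c : k) (f : U -> W) : linear f -> linear (fun x => c *: f x).
Proof. by move=> hf a x y; rewrite hf scalerDr !scalerA mulrC. Qed.

Lemma linear_add (f g : U -> W) : linear f -> linear g ->
  linear (fun x => f x + g x).
Proof. by move=> hf hg a x y; rewrite hf hg scalerDr addrACA. Qed.

Lemma linear_sub (f g : U -> W) : linear f -> linear g ->
  linear (fun x => f x - g x).
Proof. by move=> hf hg a x y; rewrite hf hg scalerBr opprD addrACA. Qed.

End LinearMaps.

Section TensorInduction.
Context {k : fieldType} {U W X : lmodType k}.

Lemma tens_ind (P : set (tensor U W)) : is_subspace P ->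
  (forall u w, P (u *t w)) -> forall x, P x.
Proof.
move=> hP Pt x.
have : span [set tens p.1 p.2 | p in [set: (U * W)%type]] x by rewrite tens_span.
by apply: (span_min hP) => _ [p _ <-].
Qed.

Lemma tens_ext (f g : tensor U W -> X) : linear f -> linear g ->
  (forall u w, f (u *t w) = g (u *t w)) -> f =1 g.
Proof. by move=> hf hg h; apply: tens_ind => //; apply: subspace_eq. Qed.

Lemma tlift_linear_param (Y : lmodType k) (f : Y -> U -> W -> X) :
  (forall c w, linear ((f c)^~ w)) -> (forall c u, linear (f c u)) ->
  (forall u w, linear (fun c => f c u w)) ->
  forall x, linear (fun c => tlift (f c) x).
Proof.
move=> hl hr hc x a c d; move: x; apply: tens_ext => [||u w].
- exact: tlift_linear.
- apply: linear_add; last exact: tlift_linear.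
  by apply: linear_scale; apply: tlift_linear.
- by rewrite !tliftE // hc.
Qed.
End TensorInduction.

Section Agreement.
Context {k : fieldType} {M N : lmodType k}.

Definition linear_on (K : set M) (d : M -> N) : Prop :=
  forall (c : k) x y, K x -> K y -> d (c *: x + y) = c *: d x + d y.

Lemma linear_on_eq (X : set M) (d d' : M -> N) :
  linear_on (span X) d -> linear_on (span X) d' ->
  (forall x, X x -> d x = d' x) -> forall x, span X x -> d x = d' x.
Proof.
move=> hd hd' dd' x hx.
suff : (span X `&` [set x | d x = d' x]) x by case.
have d0 (e : M -> N) : linear_on (span X) e -> e 0 = 0.
  move=> he; have K0 := subspace0 (span_subspace X).
  have /eqP := he 1 0 0 K0 K0; rewrite !scale1r addr0 -subr_eq0.
  by rewrite opprD addNKr oppr_eq0 => /eqP.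
move: x hx; apply: span_min => [|x Xx]; last first.
  by split; [apply: sub_span|apply: dd'].
split=> [|c x y [Kx ex] [Ky ey]]; split.
- exact: subspace0 (span_subspace X).
- by rewrite /= !d0.
- exact: (span_subspace X).2.
- by rewrite /= hd // hd' // ex ey.
Qed.
End Agreement.

Section Cut.
Context {k : fieldType} {I : finType} {T : lalgType k} (F : free_words I T).
Context {X : lmodType k} (f : T -> T -> T -> X).
Hypothesis f_lin1 : forall y z, linear (fun x => f x y z).
Hypothesis f_lin2 : forall x z, linear (fun y => f x y z).
Hypothesis f_lin3 : forall x y, linear (fun z => f x y z).
Implicit Types (x y z w : T) (s t u v : seq I) (a b n : nat).
Local Notation wd := (fw_word F).

Lemma hom_ind n (P : set T) : is_subspace P ->
  (forall s, size s = n -> P (wd s)) -> forall x, hom F n x -> P x.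
Proof.
move=> hP Pw x hx; rewrite (hom_expand hx).
apply: subspace_sum => // u _; apply: (subspaceZ hP).
by apply: Pw; rewrite size_tuple.
Qed.

(** The trilinear map f applied to the first a letters, the middle and the last
    b letters of words. *)
Definition cut a b : T -> X := fw_lift F (fun s =>
  f (wd (take a s)) (wd (drop a (take (size s - b) s))) (wd (drop (size s - b) s))).

Lemma cut_linear a b : linear (cut a b).
Proof. exact: fw_lift_linear. Qed.

Lemma cutE a b x y z : hom F a x -> hom F b z -> cut a b (x * y * z) = f x y z.
Proof.
move=> hx hz; have cl := cut_linear a b.
have ml := mulT_linearl; have mr := mulT_linearr F.
move: x hx; apply: hom_ind => [|s sa].
  apply: subspace_eq => //.
  by move=> c x x'; rewrite -cl -mulT_linearl -mulT_linearl.
move: z hz; apply: hom_ind => [|t tb].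
  apply: subspace_eq => //.
  by move=> c z z'; rewrite -cl -(mulT_linearr F).
move: y; apply: (wd_ext (F := F)) => // [c y y'|m].
  by rewrite -cl -mulT_linearl -(mulT_linearr F).
rewrite -!fw_word_cat /cut fw_lift_word !size_cat tb addnK.
have sm : size (s ++ m) = (size s + size m)%N by rewrite size_cat.
rewrite -catA take_size_cat // catA -sm take_size_cat // drop_size_cat //.
by rewrite drop_size_cat.
Qed.
End Cut.

(** * The bimodules A (x) T (x) A and their one-sided quotients *)

Section Actions.
Context {k : fieldType} {V : vectType k} {A : algType k}.
Local Notation T := (TV V).
Local Notation AT := (tensor A T).
Local Notation TA := (tensor T A).
Local Notation ATA := (tensor (tensor A T) A).
Implicit Types (a b c : A) (w : T).

Lemma mulA_linearl b : linear (fun a : A => a * b).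
Proof. by move=> c x y; rewrite mulrDl scalerAl. Qed.

Lemma mulA_linearr a : linear (fun b : A => a * b).
Proof. by move=> c x y; rewrite mulrDr scalerAr. Qed.

Let left_l a w : linear (fun b : A => (a * b) *t w).
Proof. exact: (linear_comp (mulA_linearr a) (tens_linearl w)). Qed.

Let left_r a b : linear (fun w : T => (a * b) *t w).
Proof. exact: tens_linearr. Qed.

Lemma left_actE a b w : left_act a (b *t w) = (a * b) *t w.
Proof. exact: (tliftE (left_l a) (left_r a)). Qed.

Lemma left_act_linear a : linear (left_act a : AT -> AT).
Proof. exact: (tlift_linear (left_l a) (left_r a)). Qed.

Lemma left_act_linearl (x : AT) : linear (fun a => left_act a x).
Proof.
apply: (tlift_linear_param (f := fun a b w => (a * b) *t w)) => // b w.
exact: (linear_comp (mulA_linearl b) (tens_linearl w)).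
Qed.

Let right_l b c : linear (fun w : T => w *t (c * b)).
Proof. exact: tens_linearl. Qed.

Let right_r b w : linear (fun c : A => w *t (c * b)).
Proof. exact: (linear_comp (mulA_linearl b) (tens_linearr w)). Qed.

Lemma right_actE b w c : right_act b (w *t c) = w *t (c * b).
Proof. exact: (tliftE (right_l b) (right_r b)). Qed.

Lemma right_act_linear b : linear (right_act b : TA -> TA).
Proof. exact: (tlift_linear (right_l b) (right_r b)). Qed.

Let bi_l a b c : linear (fun x : AT => left_act a x *t (c * b)).
Proof. exact: (linear_comp (left_act_linear a) (tens_linearl _)). Qed.

Let bi_r a b (x : AT) : linear (fun c : A => left_act a x *t (c * b)).
Proof. exact: (linear_comp (mulA_linearl b) (tens_linearr _)). Qed.

Lemma bi_actE a b c w d : bi_act a b (c *t w *t d) = (a * c) *t w *t (d * b).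
Proof. by rewrite -left_actE; apply: (tliftE (bi_l a b) (bi_r a b)). Qed.

Lemma bi_act_linear a b : linear (bi_act a b : ATA -> ATA).
Proof. exact: (tlift_linear (bi_l a b) (bi_r a b)). Qed.

Lemma bi_act_linearl b (x : ATA) : linear (fun a => bi_act a b x).
Proof.
apply: (tlift_linear_param (f := fun a x c => left_act a x *t (c * b))) => // y c.
exact: (linear_comp (left_act_linearl y) (tens_linearl _)).
Qed.

Lemma bi_act_linearr a (x : ATA) : linear (fun b => bi_act a b x).
Proof.
apply: (tlift_linear_param (f := fun b x c => left_act a x *t (c * b))) => // y c.
exact: (linear_comp (mulA_linearr c) (tens_linearr _)).
Qed.

Lemma ATA_ext (X : lmodType k) (f g : ATA -> X) : linear f -> linear g ->
  (forall a w b, f (a *t w *t b) = g (a *t w *t b)) -> f =1 g.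
Proof.
move=> hf hg h; apply: tens_ext => // x b; move: x.
apply: tens_ext => //.
  exact: (linear_comp (tens_linearl b) hf).
exact: (linear_comp (tens_linearl b) hg).
Qed.

Lemma bi_actA a b a' b' (x : ATA) :
  bi_act a b (bi_act a' b' x) = bi_act (a * a') (b' * b) x.
Proof.
move: x; apply: ATA_ext.
- exact: (linear_comp (bi_act_linear _ _) (bi_act_linear _ _)).
- exact: bi_act_linear.
by move=> c w d; rewrite !bi_actE !mulrA.
Qed.

Lemma bi_act1 (x : ATA) : bi_act 1 1 x = x.
Proof.
move: x; apply: ATA_ext => [|c x y|a w b] //; first exact: bi_act_linear.
by rewrite bi_actE mul1r mulr1.
Qed.

(** A (x) T (x) A is the free bimodule on T. *)
Definition bi_ext (g : T -> ATA) : ATA -> ATA :=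
  tlift (fun y b => tlift (fun a w => bi_act a b (g w)) y).

Section BiExt.
Variable g : T -> ATA.
Hypothesis g_linear : linear g.

Let in_l b w : linear (fun a => bi_act a b (g w)).
Proof. exact: bi_act_linearl. Qed.

Let in_r b a : linear (fun w => bi_act a b (g w)).
Proof. exact: (linear_comp g_linear (bi_act_linear a b)). Qed.

Let out_l b : linear (fun y : AT => tlift (fun a w => bi_act a b (g w)) y).
Proof. exact: (tlift_linear (in_l b) (in_r b)). Qed.

Let out_r (y : AT) : linear (fun b => tlift (fun a w => bi_act a b (g w)) y).
Proof.
exact: (@tlift_linear_param k A T ATA A (fun b a w => bi_act a b (g w))
  in_l in_r (fun a w => bi_act_linearr a (g w)) y).
Qed.

Lemma bi_ext_linear : linear (bi_ext g).
Proof. exact: (tlift_linear out_l out_r). Qed.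

Lemma bi_extE a w b : bi_ext g (a *t w *t b) = bi_act a b (g w).
Proof.
rewrite /bi_ext (tliftE out_l out_r (a *t w) b).
exact: (tliftE (in_l b) (in_r b)).
Qed.

Lemma bi_ext1 w : bi_ext g (1 *t w *t 1) = g w.
Proof. by rewrite bi_extE bi_act1. Qed.

Lemma bi_ext_act a b (x : ATA) : bi_ext g (bi_act a b x) = bi_act a b (bi_ext g x).
Proof.
move: x; apply: ATA_ext.
- exact: (linear_comp (bi_act_linear a b) bi_ext_linear).
- exact: (linear_comp bi_ext_linear (bi_act_linear a b)).
move=> c w d.
apply: etrans (congr1 (bi_ext g) (bi_actE a b c w d)) _.
apply: etrans (bi_extE (a * c) w (d * b)) _.
apply: etrans (esym (bi_actA a b c d (g w))) _.
have E := congr1 (bi_act a b) (bi_extE c w d). exact: esym E.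
Qed.
End BiExt.

Section Counits.
Variable e : A -> k.
Hypothesis e_linear : linear (e : A -> k^o).

Lemma counitZ_linear (M : lmodType k) (x : M) : linear (fun b : A => e b *: x).
Proof.
move=> c a b; have /= -> := e_linear c a b; rewrite scalerDl; congr (_ + _).
exact: esym (scalerA c (e a) x).
Qed.

Let btl_l b : linear (fun x : AT => e b *: x).
Proof. by move=> c x y; rewrite scalerDr !scalerA mulrC. Qed.

Let btl_r (x : AT) : linear (fun b : A => e b *: x).
Proof. exact: counitZ_linear. Qed.

Lemma bi_to_leftE (x : AT) b : bi_to_left e (x *t b) = e b *: x.
Proof. exact: (tliftE btl_l btl_r). Qed.

Lemma bi_to_left_linear : linear (bi_to_left e : ATA -> AT).
Proof. exact: (tlift_linear btl_l btl_r). Qed.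

Lemma bi_to_left_act a (x : ATA) :
  bi_to_left e (bi_act a 1 x) = left_act a (bi_to_left e x).
Proof.
move: x; apply: ATA_ext.
- exact: (linear_comp (bi_act_linear a 1) bi_to_left_linear).
- exact: (linear_comp bi_to_left_linear (left_act_linear a)).
move=> c w d; have E1 := congr1 (bi_to_left e) (bi_actE a 1 c w d).
have E2 := bi_to_leftE ((a * c) *t w) (d * 1).
have E3 := congr1 (left_act a) (bi_to_leftE (c *t w) d).
rewrite [in RHS]mulr1 -[in RHS]left_actE -[in RHS](linZ (left_act_linear a)) in E2.
exact: etrans E1 (etrans E2 (esym E3)).
Qed.

Let btr_in_l b w : linear (fun a : A => e a *: (w *t b)).
Proof. exact: counitZ_linear. Qed.

Let btr_in_r b a : linear (fun w : T => e a *: (w *t b)).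
Proof. exact: (linear_scale (e a) (tens_linearl b)). Qed.

Let btr_l b : linear (fun x : AT => tlift (fun a w => e a *: (w *t b)) x).
Proof. exact: (tlift_linear (btr_in_l b) (btr_in_r b)). Qed.

Let btr_r (x : AT) : linear (fun b => tlift (fun a w => e a *: (w *t b)) x).
Proof.
exact: (@tlift_linear_param k A T TA A (fun b a w => e a *: (w *t b))
  btr_in_l btr_in_r (fun a w => linear_scale (e a) (tens_linearr w)) x).
Qed.

Lemma bi_to_rightE a w b : bi_to_right e (a *t w *t b) = e a *: (w *t b).
Proof.
rewrite /bi_to_right (tliftE btr_l btr_r (a *t w) b).
exact: (tliftE (btr_in_l b) (btr_in_r b)).
Qed.

Lemma bi_to_right_linear : linear (bi_to_right e : ATA -> TA).
Proof. exact: (tlift_linear btr_l btr_r). Qed.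

Lemma bi_to_right_act b (x : ATA) :
  bi_to_right e (bi_act 1 b x) = right_act b (bi_to_right e x).
Proof.
move: x; apply: ATA_ext.
- exact: (linear_comp (bi_act_linear 1 b) bi_to_right_linear).
- exact: (linear_comp bi_to_right_linear (right_act_linear b)).
move=> c w d; have E1 := congr1 (bi_to_right e) (bi_actE 1 b c w d).
have E2 := bi_to_rightE (1 * c) w (d * b).
have E3 := congr1 (right_act b) (bi_to_rightE c w d).
rewrite [in RHS]mul1r -[in RHS]right_actE -[in RHS](linZ (right_act_linear b)) in E2.
exact: etrans E1 (etrans E2 (esym E3)).
Qed.
End Counits.

Let rtb_l b : linear (fun w : T => (1 : A) *t w *t b).
Proof. exact: (linear_comp (tens_linearr _) (tens_linearl b)). Qed.

Let rtb_r w : linear (fun b : A => (1 : A) *t w *t b).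
Proof. exact: tens_linearr. Qed.

Lemma right_to_biE w b : right_to_bi (w *t b) = (1 : A) *t w *t b.
Proof. exact: (tliftE rtb_l rtb_r). Qed.

Lemma right_to_bi_linear : linear (right_to_bi : TA -> ATA).
Proof. exact: (tlift_linear rtb_l rtb_r). Qed.
End Actions.

(** * The differential of the bimodule complex *)

Section BimoduleDifferential.
Context {k : fieldType} {V : vectType k} {A : algType k}.
Local Notation T := (TV V).
Local Notation F := (TV_words V).
Local Notation wd := (fw_word F).
Local Notation I := 'I_(\dim {:V}).
Local Notation ATA := (tensor (tensor A T) A).
Variables (S : set nat) (R : set T) (pi : {lrmorphism T -> A}).
Hypothesis hR : graded_relations S R.
Local Notation "W1 ** W2" := (prodS W1 W2) (at level 40, left associativity).
Implicit Types (w x y z : T) (i j l n N : nat).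

Lemma pi_linear : linear (pi : T -> A).
Proof. exact: linearP. Qed.

Let f x y z : ATA := pi x *t y *t pi z.

Let f_lin1 y z : linear (fun x => f x y z).
Proof.
exact: (linear_comp (linear_comp pi_linear (tens_linearl y)) (tens_linearl (pi z))).
Qed.

Let f_lin2 x z : linear (fun y => f x y z).
Proof. exact: (linear_comp (tens_linearr (pi x)) (tens_linearl (pi z))). Qed.

Let f_lin3 x y : linear (fun z => f x y z).
Proof. exact: (linear_comp pi_linear (tens_linearr (pi x *t y))). Qed.

Definition word_cut l r : T -> ATA := cut F f l r.

Lemma word_cut_linear l r : linear (word_cut l r).
Proof. exact: cut_linear. Qed.

Lemma word_cutE l r x y z : hom F l x -> hom F r z ->
  word_cut l r (x * y * z) = pi x *t y *t pi z.
Proof. exact: (cutE f_lin1 f_lin2 f_lin3). Qed.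

(** On the part of J_(2j) of length s j the differential is the sum of the cuts
    with N = s - 1 letters outside; N is recovered from the length. *)
Definition even_map j : T -> ATA := fw_lift F (fun s =>
  let N := (size s %/ j).-1 in \sum_(l < N.+1) word_cut l (N - l) (wd s)).

Lemma even_map_linear j : linear (even_map j).
Proof. exact: fw_lift_linear. Qed.

Lemma even_mapE j N x : (0 < j)%N -> hom F (N.+1 * j)%N x ->
  even_map j x = \sum_(l < N.+1) word_cut l (N - l) x.
Proof.
move=> j0; move: x; apply: hom_ind => [|s sN].
  apply: subspace_eq; first exact: even_map_linear.
  move=> c x y; rewrite scaler_sumr -big_split; apply: eq_bigr => l _ /=.
  exact: word_cut_linear.
by rewrite /even_map fw_lift_word sN mulnK.
Qed.

Definition diff_gen i : T -> ATA :=
  if odd i then fun w => word_cut 1 0 w - word_cut 0 1 w else even_map i./2.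

Lemma diff_gen_linear i : linear (diff_gen i).
Proof.
rewrite /diff_gen; case: odd; last exact: even_map_linear.
exact: (linear_sub (word_cut_linear _ _) (word_cut_linear _ _)).
Qed.

Lemma diff_gen_odd j w : diff_gen j.*2.+1 w = word_cut 1 0 w - word_cut 0 1 w.
Proof. by rewrite /diff_gen /= odd_double. Qed.

Lemma diff_gen_even j N w : hom F (N.+1 * j.+1)%N w ->
  diff_gen j.+1.*2 w = \sum_(l < N.+1) word_cut l (N - l) w.
Proof.
by move=> hw; rewrite /diff_gen odd_double doubleK; apply: even_mapE.
Qed.

(** This is the differential of degree i > 0: it satisfies the conditions imposed on
    it ([bidiff_is_bi_diff]), which determine it on the i-th term
    ([bi_diff_eq]). *)
Definition bidiff i : ATA -> ATA := bi_ext (diff_gen i).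

(** A decomposition of x as a sum of products, for x in V^(l) W V^(r) whatever W
    is. *)
Definition sandwich_seq l r x : seq (T * T * T) :=
  [seq (wd q.1, mid F q.1 q.2 x, wd q.2) |
     q : (l.-tuple I * r.-tuple I)%type <- index_enum _].

Lemma sandwich_seqP l r W x : is_subspace W -> (Vpow l ** W ** Vpow r) x ->
  (forall p, p \in sandwich_seq l r x -> [/\ Vpow l p.1.1, W p.1.2 & Vpow r p.2])
  /\ x = \sum_(p <- sandwich_seq l r x) p.1.1 * p.1.2 * p.2.
Proof.
move=> hW; rewrite !VpowE => /(sandwichP F _ _ hW)[xlr hx]; split.
  move=> _ /mapP[[u v] _ ->] /=; split.
  - by rewrite -[X in hom F X](size_tuple u); apply: hom_wd.
  - by apply: hx; rewrite size_tuple.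
  - by rewrite -[X in hom F X](size_tuple v); apply: hom_wd.
rewrite big_map /= {1}(expand xlr) pair_big /=.
by apply: eq_bigr => -[u v] _.
Qed.

Lemma bi_term_subspace (W : set T) : is_subspace (bi_term (A := A) W).
Proof. exact: span_subspace. Qed.

Lemma bi_term_tens (W : set T) (a b : A) w : W w -> bi_term W (a *t w *t b).
Proof.
by move=> Ww; apply: sub_span; exists (a *t w); [exists a => //; exists w|exists b].
Qed.

Lemma bi_term_min (W : set T) (P : set ATA) : is_subspace P ->
  (forall a w b, W w -> P (a *t w *t b)) -> bi_term W `<=` P.
Proof.
move=> hP h; apply: span_min => // _ [_ [a _ [w Ww <-]] [b _ <-]]; exact: h.
Qed.

Lemma word_cut_sandwich l r (W : set T) w : is_subspace W -> (Vpow l ** W ** Vpow r) w ->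
  bi_term W (word_cut l r w).
Proof.
move=> hW /(sandwich_seqP hW)[hs ->]; rewrite (lin_sum (word_cut_linear _ _)).
rewrite big_seq; apply: subspace_sum => [|p /hs[]]; first exact: bi_term_subspace.
by rewrite !VpowE => h1 h2 h3; rewrite word_cutE //; apply: bi_term_tens.
Qed.
End BimoduleDifferential.

Section BimoduleComplex.
Context {k : fieldType} {V : vectType k} {A : algType k}.
Local Notation T := (TV V).
Local Notation F := (TV_words V).
Local Notation ATA := (tensor (tensor A T) A).
Local Notation "W1 ** W2" := (prodS W1 W2) (at level 40, left associativity).
Variables (S : set nat) (R : set T) (pi : {lrmorphism T -> A}).
Hypothesis hR : graded_relations S R.
Implicit Types (w x y z : T) (i j l n N : nat).
Local Notation word_cut := (word_cut pi).
Local Notation diff_gen := (diff_gen pi).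
Local Notation bidiff := (bidiff pi).

Lemma word_cutl l x y : hom F l x -> word_cut l 0 (x * y) = pi x *t y *t 1.
Proof.
move=> hx; rewrite -[x * y]mulr1 (word_cutE pi (z := 1) y hx) ?rmorph1 //.
by rewrite -(oneSE F); apply: sub_span.
Qed.

Lemma word_cutr r y z : hom F r z -> word_cut 0 r (y * z) = 1 *t y *t pi z.
Proof.
move=> hz; rewrite -[y]mul1r (word_cutE pi (x := 1) y _ hz) ?rmorph1 ?mul1r //.
by rewrite -(oneSE F); apply: sub_span.
Qed.

Lemma J_subspace i : is_subspace (J R i).
Proof. by rewrite (J_HR_J hR); apply: HR_J_subspace. Qed.

Lemma J_odd_sandwich j w : J R j.*2.+1 w ->
  (Vpow 1 ** J R j.*2 ** Vpow 0) w /\ (Vpow 0 ** J R j.*2 ** Vpow 1) w.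
Proof.
rewrite J_odd gen_Vpow => -[hl hr].
by rewrite prodS_unit ?unit_prodS //; [apply: J_subspace|apply: mulS_subspace].
Qed.

Lemma diff_gen_term i w : J R i.+1 w -> bi_term (J R i) (diff_gen i.+1 w).
Proof.
rewrite -(odd_double_half i); case: (odd i); rewrite ?add1n ?add0n; last first.
  move=> /J_odd_sandwich[hl hr]; rewrite diff_gen_odd.
  apply: (subspaceB (bi_term_subspace _)); apply: word_cut_sandwich => //;
    exact: J_subspace.
rewrite -doubleS; move: i./2 => j hw; have [n h] := J_series hR hw.
rewrite (h n) // (lin_sum (diff_gen_linear pi _)).
apply: subspace_sum => [|N _]; first exact: bi_term_subspace.
rewrite (diff_gen_even _ (@proj_hom _ _ _ F _ _)).
apply: subspace_sum => [|l _]; first exact: bi_term_subspace.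
apply: word_cut_sandwich; first exact: J_subspace.
by apply: (J_cap_proj hR hw); rewrite -ltnS.
Qed.

Lemma bidiff_linear i : linear (bidiff i).
Proof. exact: (bi_ext_linear (diff_gen_linear pi i)). Qed.

Lemma bidiffE i a w b : bidiff i (a *t w *t b) = bi_act a b (diff_gen i w).
Proof. exact: (bi_extE (diff_gen_linear pi i)). Qed.

Lemma bidiff1 i w : bidiff i (1 *t w *t 1) = diff_gen i w.
Proof. exact: (bi_ext1 (diff_gen_linear pi i)). Qed.

Lemma bidiff_bimodule_map i :
  bimodule_map (bidiff i.+1) (bi_term (J R i.+1)) (bi_term (J R i)).
Proof.
split=> [||a b x _].
- apply: bi_term_min.
    exact: (subspace_preim (bidiff_linear i.+1) (bi_term_subspace _)).
  move=> a w b hw; rewrite /= bidiffE.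
  have := diff_gen_term hw; move: (diff_gen _ _).
  apply: bi_term_min.
    exact: (subspace_preim (bi_act_linear a b) (bi_term_subspace _)).
  by move=> a' w' b' hw'; rewrite /= bi_actE; apply: bi_term_tens.
- by move=> c x y _ _; apply: bidiff_linear.
- exact: (bi_ext_act (diff_gen_linear pi i.+1)).
Qed.

Lemma bidiff_odd_formula j : odd_formula pi R j (bidiff j.*2.+1).
Proof.
move=> w s s' _ hs ws hs' ws'.
rewrite bidiff1 diff_gen_odd; congr (_ - _).
  rewrite ws (lin_sum (word_cut_linear pi _ _)); apply: eq_big_seq => p /hs[].
  by rewrite genE => h _; apply: word_cutl.
rewrite ws' (lin_sum (word_cut_linear pi _ _)); apply: eq_big_seq => p /hs'[_].
by rewrite genE; apply: word_cutr.
Qed.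

Lemma bidiff_even_formula j : even_formula pi R j.+1 (bidiff j.+1.*2).
Proof.
move=> w n wN s hw sumw capN hs.
rewrite bidiff1 {1}sumw (lin_sum (diff_gen_linear pi _)).
apply: eq_bigr => N _; have hN := ltn_ord N.
rewrite (@diff_gen_even _ _ _ pi _ N); last first.
  by rewrite (J_cap_unique hR hw sumw capN hN); apply: proj_hom.
apply: eq_bigr => l _; have [hp ->] := hs N l hN (ltn_ord l).
rewrite (lin_sum (word_cut_linear pi _ _)); apply: eq_big_seq => p /hp[].
by rewrite !VpowE => h1 _ h3; apply: word_cutE.
Qed.

Lemma bidiff_is_bi_diff i : is_bi_diff pi R i.+1 (bidiff i.+1).
Proof.
split; first exact: bidiff_bimodule_map.
rewrite -(odd_double_half i); case: (odd i); rewrite ?add1n ?add0n.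
  by rewrite -doubleS odd_double doubleK; apply: bidiff_even_formula.
by rewrite /= odd_double /= uphalf_double; apply: bidiff_odd_formula.
Qed.

(** Every element of J_(i+1) has decompositions of the kind that occur in the
    formulas ([sandwich_seqP], [J_series]), so the formulas determine d. *)
Lemma is_bi_diff_unique i d w : is_bi_diff pi R i.+1 d -> J R i.+1 w ->
  d (1 *t w *t 1) = bidiff i.+1 (1 *t w *t 1).
Proof.
move=> [_ hd]; have [_ hb] := bidiff_is_bi_diff i; move: hd hb.
rewrite -(odd_double_half i); case: (odd i); rewrite ?add1n ?add0n.
  rewrite -doubleS odd_double doubleK; move: i./2 => j hd hb hw.
  have [n h] := J_series hR hw; pose wN N := proj F (N.+1 * j.+1)%N w.
  pose s N l := sandwich_seq l (N - l) (wN N).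
  have capN N : (N < n)%N -> J_cap R j.+1 N (wN N) by move=> _; apply: (J_cap_proj hR).
  have hs N l : (N < n)%N -> (l <= N)%N -> (forall p, p \in s N l ->
      [/\ Vpow l p.1.1, J R j.+1.*2.-1 p.1.2 & Vpow (N - l) p.2]) /\
      wN N = \sum_(p <- s N l) p.1.1 * p.1.2 * p.2.
    move=> Nn lN; apply: sandwich_seqP; first exact: J_subspace.
    exact: capN.
  have sumw := h n (leqnn n).
  by rewrite (hd w n wN s hw sumw capN hs) (hb w n wN s hw sumw capN hs).
rewrite /= odd_double /= uphalf_double; move: i./2 => j hd hb hw.
have hJ := J_subspace j.*2.
have [/(sandwich_seqP hJ)[hl wl] /(sandwich_seqP hJ)[hr wr]] := J_odd_sandwich hw.
pose s := [seq (p.1.1, p.1.2 * p.2) | p <- sandwich_seq 1 0 w].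
pose s' := [seq (p.1.1 * p.1.2, p.2) | p <- sandwich_seq 0 1 w].
have hs p : p \in s -> gen p.1 /\ J R j.*2 p.2.
  move=> /mapP[q /hl[h1 h2 h3] ->] /=; rewrite gen_Vpow; split=> //.
  by rewrite -(prodS_unit hJ); apply: mulS_mul.
have hs' p : p \in s' -> J R j.*2 p.1 /\ gen p.2.
  move=> /mapP[q /hr[h1 h2 h3] ->] /=; rewrite gen_Vpow; split=> //.
  by rewrite -(unit_prodS hJ); apply: mulS_mul.
have ws : w = \sum_(p <- s) p.1 * p.2.
  by rewrite big_map {1}wl; apply: eq_bigr => p _; rewrite mulrA.
have ws' : w = \sum_(p <- s') p.1 * p.2 by rewrite big_map.
by rewrite (hd w s s' hw hs ws hs' ws') (hb w s s' hw hs ws hs' ws').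
Qed.

Lemma bi_diff_eq i (x : ATA) : bi_term (J R i.+1) x -> bi_diff pi R i.+1 x = bidiff i.+1 x.
Proof.
have hd : is_bi_diff pi R i.+1 (bi_diff pi R i.+1).
  apply: (xgetPex (fun=> 0) (P := [set d | is_bi_diff pi R i.+1 d])).
  by exists (bidiff i.+1); apply: bidiff_is_bi_diff.
move: x; apply: linear_on_eq; first by case: hd => -[].
  by move=> c x y _ _; apply: bidiff_linear.
move=> _ [_ [a _ [w hw <-]] [b _ <-]].
have E : a *t w *t b = bi_act a b (1 *t w *t 1) :> ATA.
  by rewrite bi_actE mulr1 mul1r.
have w1 : bi_term (J R i.+1) ((1 : A) *t w *t (1 : A)) by apply: bi_term_tens.
have [[_ _ dact] _] := hd.
apply: etrans (congr1 _ E) _; apply: etrans (dact a b _ w1) _.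
apply: etrans (congr1 (bi_act a b) (is_bi_diff_unique hd hw)) _.
apply: etrans _ (esym (congr1 (bidiff i.+1) E)).
exact: esym (bi_ext_act (diff_gen_linear pi i.+1) a b _).
Qed.
End BimoduleComplex.

(** * The one-sided complexes *)

Section OneSided.
Context {k : fieldType} {V : vectType k} {A : algType k}.
Local Notation T := (TV V).
Local Notation F := (TV_words V).
Local Notation wd := (fw_word F).
Local Notation AT := (tensor A T).
Local Notation TA := (tensor T A).
Local Notation ATA := (tensor (tensor A T) A).
Variables (S : set nat) (R : set T) (pi : {lrmorphism T -> A}).
Variable eps : {lrmorphism A -> k^o}.
Hypothesis hR : graded_relations S R.
Hypothesis heps : is_augmentation pi eps.
Implicit Types (w x y z : T) (a b : A) (i j l r n s m : nat).
Local Notation word_cut := (word_cut pi).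
Local Notation diff_gen := (diff_gen pi).
Local Notation bidiff := (bidiff pi).

Let e : A -> k := eps.

Let e_linear : linear (e : A -> k^o).
Proof. exact: linearP. Qed.

Let e1 : e 1 = 1.
Proof. exact: rmorph1. Qed.

Let btl := bi_to_left_linear (V := V) e_linear.
Let btr := bi_to_right_linear (V := V) e_linear.

Lemma augmentation_word v : (0 < size v)%N -> e (pi (wd v)) = 0.
Proof.
case/lastP: v => // v q _; rewrite -cats1 fw_word_cat rmorphM.
have h : eps (pi (wd [:: q])) = 0 by rewrite -inV_basis; apply: heps.
apply: etrans (rmorphM eps (pi (wd v)) (pi (wd [:: q]))) _.
by apply: etrans (congr1 (fun c : k^o => eps (pi (wd v)) * c) h) _; apply: mulr0.
Qed.

Lemma bi_to_left_cut l r w : (0 < r)%N -> from F (l + r)%N w ->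
  bi_to_left e (word_cut l r w) = 0.
Proof.
move=> r0 hw; rewrite (expand hw) (lin_sum (word_cut_linear pi _ _)) (lin_sum btl).
rewrite big1 // => u _; rewrite (lin_sum (word_cut_linear pi _ _)) (lin_sum btl).
rewrite big1 // => v _; rewrite word_cutE.
- by rewrite (bi_to_leftE e_linear) augmentation_word ?scale0r ?size_tuple.
- by rewrite -[X in hom F X](size_tuple u); apply: hom_wd.
- by rewrite -[X in hom F X](size_tuple v); apply: hom_wd.
Qed.

Lemma bi_to_left_cut0 l x y : hom F l x ->
  bi_to_left e (word_cut l 0 (x * y)) = pi x *t y.
Proof. by move=> hx; rewrite word_cutl // (bi_to_leftE e_linear) e1 scale1r. Qed.

Lemma bi_to_right_cut l r w : (0 < l)%N -> from F (l + r)%N w ->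
  bi_to_right e (word_cut l r w) = 0.
Proof.
move=> r0 hw; rewrite (expand hw) (lin_sum (word_cut_linear pi _ _)) (lin_sum btr).
rewrite big1 // => u _; rewrite (lin_sum (word_cut_linear pi _ _)) (lin_sum btr).
rewrite big1 // => v _; rewrite word_cutE.
- by rewrite (bi_to_rightE e_linear) augmentation_word ?scale0r ?size_tuple.
- by rewrite -[X in hom F X](size_tuple u); apply: hom_wd.
- by rewrite -[X in hom F X](size_tuple v); apply: hom_wd.
Qed.

Lemma bi_to_right_cut0 r y z : hom F r z ->
  bi_to_right e (word_cut 0 r (y * z)) = y *t pi z.
Proof. by move=> hz; rewrite word_cutr // (bi_to_rightE e_linear) e1 scale1r. Qed.

Lemma hr_deg_mono s i : S s \/ i = 0%N -> (hr_deg s i <= hr_deg s i.+1)%N.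
Proof.
case=> [Ss|->]; last by rewrite /hr_deg muln0.
have s2 := S_ge2 hR Ss; rewrite -(odd_double_half i).
case: (odd i); rewrite ?add1n ?add0n -?doubleS ?hr_deg_double ?hr_deg_doubleS //.
  by rewrite mulnS addnC leq_add2r; lia.
by rewrite leq_addr.
Qed.

(** Among the cuts of a word only the one with all outer letters on the left
    survives the augmentation on the right.  In even degrees it cuts after
    s - 1 letters and in odd degrees after one, which in both cases is
    n_s(i+1) - n_s(i). *)
Lemma left_gen s i x y : S s \/ i = 0%N ->
  hom F (hr_deg s i.+1 - hr_deg s i)%N x -> hom F (hr_deg s i) y ->
  bi_to_left e (diff_gen i.+1 (x * y)) = pi x *t y.
Proof.
move=> Si hx hy; have := hom_mul hx hy; rewrite subnK ?hr_deg_mono // => hxy.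
move: Si hx hy hxy; rewrite -(odd_double_half i); case: (odd i) => /=.
  rewrite add1n -doubleS; case=> // Ss; have s2 := S_ge2 hR Ss.
  rewrite hr_deg_double hr_deg_doubleS => hx hy hxy.
  have Em : (s * (i./2).+1 - (s * i./2 + 1) = s.-1)%N by rewrite mulnS; lia.
  have hxy' : hom F (s.-1.+1 * (i./2).+1)%N (x * y) by rewrite prednK // ltnW.
  rewrite (diff_gen_even _ hxy') (lin_sum btl) big_ord_recr /= subnn.
  rewrite -[RHS]add0r; congr (_ + _); last by apply: bi_to_left_cut0; rewrite -Em.
  apply: big1 => l _; apply: bi_to_left_cut; first by rewrite subn_gt0.
  apply: hom_from hxy _; rewrite subnKC; last exact: ltnW.
  by rewrite mulnS; lia.
rewrite add0n hr_deg_double hr_deg_doubleS addKn => _ hx hy hxy.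
rewrite diff_gen_odd (linB btl) -[RHS]subr0; congr (_ - _).
  exact: bi_to_left_cut0.
by apply: bi_to_left_cut => //; apply: hom_from hxy _; rewrite leq_addl.
Qed.

(** Here the cut with all outer letters on the right survives; in odd degrees it
    is the one with the negative sign. *)
Lemma right_gen s i x z : S s \/ i = 0%N ->
  hom F (hr_deg s i) x -> hom F (hr_deg s i.+1 - hr_deg s i)%N z ->
  bi_to_right e (diff_gen i.+1 (x * z)) = (-1) ^+ i.+1 *: (x *t pi z).
Proof.
move=> Si hx hz; have := hom_mul hx hz; rewrite subnKC ?hr_deg_mono // => hxz.
move: Si hx hz hxz; rewrite -(odd_double_half i); case: (odd i) => /=.
  rewrite add1n -doubleS; case=> // Ss; have s2 := S_ge2 hR Ss.
  rewrite hr_deg_double hr_deg_doubleS => hx hz hxz.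
  have Em : (s * (i./2).+1 - (s * i./2 + 1) = s.-1)%N by rewrite mulnS; lia.
  have hxz' : hom F (s.-1.+1 * (i./2).+1)%N (x * z) by rewrite prednK // ltnW.
  rewrite (diff_gen_even _ hxz') (lin_sum btr) big_ord_recl /= subn0.
  rewrite -[RHS]addr0; congr (_ + _).
    rewrite -mul2n exprM sqrrN !expr1n scale1r.
    by apply: bi_to_right_cut0; rewrite -Em.
  apply: big1 => l _; apply: bi_to_right_cut => //.
  apply: hom_from hxz _; rewrite subnKC; last exact: (ltn_ord l).
  by rewrite mulnS; lia.
rewrite add0n hr_deg_double hr_deg_doubleS addKn => _ hx hz hxz.
rewrite diff_gen_odd (linB btr) exprS -mul2n exprM sqrrN !expr1n mulr1 scaleN1r.
rewrite -[RHS]sub0r; congr (_ - _); last exact: bi_to_right_cut0.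
by apply: bi_to_right_cut => //; apply: hom_from hxz _; rewrite leq_addl.
Qed.

Lemma prodV_hom (t : seq V) : hom F (size t) (prodV t).
Proof.
rewrite /prodV; elim: t => [|v t IHt].
  by rewrite big_nil -(oneSE F); apply: sub_span.
rewrite big_cons -[size _]/(1 + size t)%N; apply: hom_mul => //.
by rewrite -genE; exists v.
Qed.

Lemma prodV_split m (t : seq V) : prodV t = prodV (take m t) * prodV (drop m t).
Proof. by rewrite /prodV -big_cat cat_take_drop. Qed.

Lemma word_prodV (t : seq 'I_(\dim {:V})) :
  wd t = prodV [seq (vbasis {:V})`_(q : 'I_(\dim {:V})) | q <- t].
Proof.
rewrite /prodV big_map; elim: t => [|q t IHt]; first by rewrite big_nil fw_word_nil.
by rewrite big_cons -IHt -cat1s fw_word_cat inV_basis.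
Qed.
End OneSided.

Section HerscovichReyDifferentials.
Context {k : fieldType} {V : vectType k} {A : algType k}.
Local Notation T := (TV V).
Local Notation F := (TV_words V).
Local Notation wd := (fw_word F).
Local Notation AT := (tensor A T).
Local Notation TA := (tensor T A).
Local Notation ATA := (tensor (tensor A T) A).
Variables (S : set nat) (R : set T) (pi : {lrmorphism T -> A}).
Variable eps : {lrmorphism A -> k^o}.
Hypothesis hR : graded_relations S R.
Hypothesis heps : is_augmentation pi eps.
Implicit Types (w : T) (a b : A) (i j s m : nat).
Local Notation diff_gen := (diff_gen pi).
Local Notation bidiff := (bidiff pi).

Let e : A -> k := eps.

Let e_linear : linear (e : A -> k^o).
Proof. exact: linearP. Qed.

Let btl := bi_to_left_linear (V := V) e_linear.
Let btr := bi_to_right_linear (V := V) e_linear.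

(** The differentials are linear only on their terms; nevertheless they are
    determined by the summands of index s. *)
Lemma HR_J_agree i (N : lmodType k) (d d' : T -> N) :
  linear_on (HR_J S R i) d -> linear_on (HR_J S R i) d' -> (0 < i)%N ->
  (forall s w, S s \/ i = 1%N -> HR_Js R s i w -> d w = d' w) ->
  forall w, HR_J S R i w -> d w = d' w.
Proof.
rewrite /HR_J; case: ifP => i2 dl dl' i0 h.
  have i1 : i = 1%N by lia.
  by move=> w hw; apply: (h 0%N); [right|rewrite /HR_Js i2].
by apply: linear_on_eq => // w [s Ss]; apply: h; left.
Qed.

Lemma linear_on_comp (M N : lmodType k) (K : set M) (W : set T) (d : M -> N)
    (h : T -> M) : linear h -> linear_on K d -> (forall w, W w -> K (h w)) ->
  linear_on W (fun w => d (h w)).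
Proof. by move=> hl dl WK c x y Wx Wy; rewrite hl dl //; apply: WK. Qed.

Lemma HR_Js_hom s i w : S s \/ i = 1%N -> HR_Js R s i w -> hom F (hr_deg s i) w.
Proof.
case=> [Ss|->].
  by rewrite (HR_JsE hR) ?(S_ge2 hR) // => /chainR_hom.
by rewrite (_ : HR_Js R s 1 = Vpow 1) // VpowE /hr_deg muln0.
Qed.

Section Left.

Definition left_diff i (x : AT) : AT := bi_to_left e (bidiff i (x *t 1)).

Lemma left_diff_linear i : linear (left_diff i).
Proof.
exact: (linear_comp (linear_comp (tens_linearl 1) (bidiff_linear pi i)) btl).
Qed.

Lemma left_diffE i a w :
  left_diff i (a *t w) = left_act a (bi_to_left e (diff_gen i w)).
Proof.
by rewrite /left_diff (bidiffE pi i a w 1) (bi_to_left_act e_linear).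
Qed.

Lemma left_actA a b (x : AT) : left_act a (left_act b x) = left_act (a * b) x.
Proof.
move: x; apply: tens_ext.
- exact: (linear_comp (left_act_linear b) (left_act_linear a)).
- exact: left_act_linear.
by move=> c w; rewrite !left_actE mulrA.
Qed.

Lemma left_diff_act i a (x : AT) :
  left_diff i (left_act a x) = left_act a (left_diff i x).
Proof.
move: x; apply: tens_ext.
- exact: (linear_comp (left_act_linear a) (left_diff_linear i)).
- exact: (linear_comp (left_diff_linear i) (left_act_linear a)).
move=> b w; apply: etrans (congr1 (left_diff i) (left_actE a b w)) _.
apply: etrans (left_diffE i (a * b) w) _.
apply: etrans (esym (left_actA a b _)) _.
exact: (congr1 (left_act a) (esym (left_diffE i b w))).
Qed.

Lemma left_term_subspace (W : set T) : is_subspace (left_term (A := A) W).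
Proof. exact: span_subspace. Qed.

Lemma left_term_tens (W : set T) a w : W w -> left_term W (a *t w).
Proof. by move=> Ww; apply: sub_span; exists a => //; exists w. Qed.

Lemma left_term_min (W : set T) (P : set AT) : is_subspace P ->
  (forall a w, W w -> P (a *t w)) -> left_term W `<=` P.
Proof.
by move=> hP h; apply: span_min => // _ [a _ [w Ww <-]]; apply: h.
Qed.

Lemma left_diff_term i (x : AT) :
  left_term (J R i.+1) x -> left_term (J R i) (left_diff i.+1 x).
Proof.
move: x; apply: left_term_min.
  exact: (subspace_preim (left_diff_linear _) (left_term_subspace _)).
move=> a w hw; have [bt _ _] := bidiff_bimodule_map pi hR i.
have := bt _ (bi_term_tens a 1 hw); rewrite /= /left_diff.
move: (bidiff _ _); apply: bi_term_min.
  exact: (subspace_preim btl (left_term_subspace _)).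
move=> a' w' b' hw'; rewrite /= (bi_to_leftE e_linear).
by apply: (subspaceZ (left_term_subspace _)); apply: left_term_tens.
Qed.

Lemma left_diff_formula i s (r : seq (A * (hr_deg s i.+1).-tuple V)) :
  S s \/ i = 0%N -> let m := (hr_deg s i.+1 - hr_deg s i)%N in
  left_diff i.+1 (\sum_(p <- r) p.1 *t prodV p.2) =
  \sum_(p <- r) (p.1 * pi (prodV (take m p.2))) *t prodV (drop m p.2).
Proof.
move=> Si m; rewrite (lin_sum (left_diff_linear _)); apply: eq_bigr => -[a t] _ /=.
rewrite left_diffE (prodV_split m t).
have le := hr_deg_mono hR Si.
have hm : size (take m t) = m by rewrite size_takel // size_tuple leq_subr.
have hd : size (drop m t) = hr_deg s i by rewrite size_drop size_tuple subKn.
rewrite (@left_gen _ _ _ _ _ _ _ hR heps s) //; first exact: left_actE.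
  by rewrite -/m -[X in hom F X]hm; apply: prodV_hom.
by rewrite -[X in hom F X]hd; apply: prodV_hom.
Qed.

Lemma left_diff_HR i : is_HRleft_diff pi S R i.+1 (left_diff i.+1).
Proof.
split.
  split=> [x|c x y _ _|a x _]; last exact: left_diff_act.
    by rewrite /HRleft -!(J_HR_J hR); apply: left_diff_term.
  exact: left_diff_linear.
move=> s r Si m x _; apply: left_diff_formula.
by case: Si => [|[]]; [left|right].
Qed.

(** For w in the summand of index s, expand w in the basis of words; the formula
    imposed on d applies to the expansion of a (x) w. *)
Lemma is_HRleft_diff_unique i d (x : AT) : is_HRleft_diff pi S R i.+1 d ->
  HRleft S R i.+1 x -> d x = left_diff i.+1 x.
Proof.
move=> [[_ dl _] hd]; move: x.
apply: linear_on_eq => //; first by move=> c x y _ _; apply: left_diff_linear.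
move=> _ [a _ [w hw <-]].
have inK w' : HR_J S R i.+1 w' -> HRleft S R i.+1 (a *t w').
  exact: left_term_tens.
have tl := tens_linearr (W := T) a.
apply: (HR_J_agree (d := fun w => d (a *t w))
  (d' := fun w => left_diff i.+1 (a *t w)) _ _ _ _ hw) => //.
- exact: linear_on_comp tl dl inK.
- by move=> c y z _ _; apply: (linear_comp tl (left_diff_linear i.+1)).
move=> s {hw}w Si hw.
have Si' : S s \/ i = 0%N by case: Si => [|[]]; [left|right].
pose r := [seq (fw_coef F w u *: a,
    map_tuple (fun q : 'I_(\dim {:V}) => (vbasis {:V})`_q) u) |
  u : (hr_deg s i.+1).-tuple 'I_(\dim {:V}) <- index_enum _].
have E : a *t w = \sum_(p <- r) p.1 *t prodV p.2.
  rewrite big_map {1}(hom_expand (HR_Js_hom Si hw)) (lin_sum tl).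
  apply: eq_bigr => u _ /=; rewrite -word_prodV (linZ tl).
  exact: esym (linZ (tens_linearl _) _ _).
have xK : left_term (HR_Js R s i.+1) (\sum_(p <- r) p.1 *t prodV p.2).
  by rewrite -E; apply: left_term_tens.
apply: etrans (congr1 d E) _; apply: etrans (hd s r Si xK) _.
apply: etrans (esym (left_diff_formula r Si')) _.
exact: (congr1 (left_diff i.+1) (esym E)).
Qed.
End Left.

Section Right.

Definition right_diff i (x : TA) : TA := bi_to_right e (bidiff i (right_to_bi x)).

Lemma right_diff_linear i : linear (right_diff i).
Proof.
exact: (linear_comp (linear_comp right_to_bi_linear (bidiff_linear pi i)) btr).
Qed.

Lemma right_diffE i w b :
  right_diff i (w *t b) = right_act b (bi_to_right e (diff_gen i w)).
Proof.
apply: etrans (congr1 (fun x => bi_to_right e (bidiff i x)) (right_to_biE w b)) _.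
apply: etrans (congr1 (bi_to_right e) (bidiffE pi i 1 w b)) _.
exact: bi_to_right_act.
Qed.

Lemma right_actA a b (x : TA) : right_act a (right_act b x) = right_act (b * a) x.
Proof.
move: x; apply: tens_ext.
- exact: (linear_comp (right_act_linear b) (right_act_linear a)).
- exact: right_act_linear.
by move=> w c; rewrite !right_actE mulrA.
Qed.

Lemma right_diff_act i b (x : TA) :
  right_diff i (right_act b x) = right_act b (right_diff i x).
Proof.
move: x; apply: tens_ext.
- exact: (linear_comp (right_act_linear b) (right_diff_linear i)).
- exact: (linear_comp (right_diff_linear i) (right_act_linear b)).
move=> w c; apply: etrans (congr1 (right_diff i) (right_actE b w c)) _.
apply: etrans (right_diffE i w (c * b)) _.
apply: etrans (esym (right_actA b c _)) _.
exact: (congr1 (right_act b) (esym (right_diffE i w c))).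
Qed.

Lemma right_term_subspace (W : set T) : is_subspace (right_term (A := A) W).
Proof. exact: span_subspace. Qed.

Lemma right_term_tens (W : set T) w b : W w -> right_term W (w *t b).
Proof. by move=> Ww; apply: sub_span; exists w => //; exists b. Qed.

Lemma right_term_min (W : set T) (P : set TA) : is_subspace P ->
  (forall w b, W w -> P (w *t b)) -> right_term W `<=` P.
Proof.
by move=> hP h; apply: span_min => // _ [w Ww [b _ <-]]; apply: h.
Qed.

Lemma right_diff_term i (x : TA) :
  right_term (J R i.+1) x -> right_term (J R i) (right_diff i.+1 x).
Proof.
move: x; apply: right_term_min.
  exact: (subspace_preim (right_diff_linear _) (right_term_subspace _)).
move=> w b hw; have [bt _ _] := bidiff_bimodule_map pi hR i.
have := bt _ (bi_term_tens 1 b hw); rewrite -right_to_biE /= /right_diff.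
move: (bidiff _ _); apply: bi_term_min.
  exact: (subspace_preim btr (right_term_subspace _)).
move=> a' w' b' hw'; rewrite /= (bi_to_rightE e_linear).
by apply: (subspaceZ (right_term_subspace _)); apply: right_term_tens.
Qed.

Lemma right_diff_formula i s (r : seq ((hr_deg s i.+1).-tuple V * A)) :
  S s \/ i = 0%N -> let m := hr_deg s i in
  right_diff i.+1 (\sum_(p <- r) prodV p.1 *t p.2) =
  (-1) ^+ i.+1 *:
    \sum_(p <- r) prodV (take m p.1) *t (pi (prodV (drop m p.1)) * p.2).
Proof.
move=> Si m; rewrite (lin_sum (right_diff_linear _)) scaler_sumr.
apply: eq_bigr => -[t b] _ /=.
rewrite right_diffE (prodV_split m t).
have le := hr_deg_mono hR Si.
have hm : size (take m t) = m by rewrite size_takel // size_tuple.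
have hd : size (drop m t) = (hr_deg s i.+1 - m)%N by rewrite size_drop size_tuple.
rewrite (@right_gen _ _ _ _ _ _ _ hR heps s) //.
- by rewrite (linZ (right_act_linear b)) right_actE.
- by rewrite -/m -[X in hom F X]hm; apply: prodV_hom.
- by rewrite -/m -[X in hom F X]hd; apply: prodV_hom.
Qed.

Lemma right_diff_HR i : is_HRright_diff pi S R i.+1 (right_diff i.+1).
Proof.
split.
  split=> [x|c x y _ _|a x _]; last exact: right_diff_act.
    by rewrite /HRright -!(J_HR_J hR); apply: right_diff_term.
  exact: right_diff_linear.
move=> s r Si m x _; apply: right_diff_formula.
by case: Si => [|[]]; [left|right].
Qed.

Lemma is_HRright_diff_unique i d (x : TA) : is_HRright_diff pi S R i.+1 d ->
  HRright S R i.+1 x -> d x = right_diff i.+1 x.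
Proof.
move=> [[_ dl _] hd]; move: x.
apply: linear_on_eq => //; first by move=> c x y _ _; apply: right_diff_linear.
move=> _ [w hw [b _ <-]].
have inK w' : HR_J S R i.+1 w' -> HRright S R i.+1 (w' *t b).
  exact: right_term_tens.
have tl := tens_linearl (U := T) b.
apply: (HR_J_agree (d := fun w => d (w *t b))
  (d' := fun w => right_diff i.+1 (w *t b)) _ _ _ _ hw) => //.
- exact: linear_on_comp tl dl inK.
- by move=> c y z _ _; apply: (linear_comp tl (right_diff_linear i.+1)).
move=> s {hw}w Si hw.
have Si' : S s \/ i = 0%N by case: Si => [|[]]; [left|right].
pose r := [seq (map_tuple (fun q : 'I_(\dim {:V}) => (vbasis {:V})`_q) u,
    fw_coef F w u *: b) |
  u : (hr_deg s i.+1).-tuple 'I_(\dim {:V}) <- index_enum _].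
have E : w *t b = \sum_(p <- r) prodV p.1 *t p.2.
  rewrite big_map {1}(hom_expand (HR_Js_hom Si hw)) (lin_sum tl).
  apply: eq_bigr => u _ /=; rewrite -word_prodV (linZ tl).
  exact: esym (linZ (tens_linearr _) _ _).
have xK : right_term (HR_Js R s i.+1) (\sum_(p <- r) prodV p.1 *t p.2).
  by rewrite -E; apply: right_term_tens.
apply: etrans (congr1 d E) _; apply: etrans (hd s r Si xK) _.
apply: etrans (esym (right_diff_formula r Si')) _.
exact: (congr1 (right_diff i.+1) (esym E)).
Qed.
End Right.
End HerscovichReyDifferentials.

(** * The coincidence of the complexes *)

Section Comparison.
Context {k : fieldType} {V : vectType k} {A : algType k}.
Local Notation T := (TV V).
Variables (S : set nat) (R : set T) (pi : {lrmorphism T -> A}).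
Variable eps : {lrmorphism A -> k^o}.
Hypothesis hR : graded_relations S R.
Hypothesis heps : is_augmentation pi eps.

Lemma Kleft_diffE i (x : tensor A T) : Kleft R i.+1 x ->
  Kleft_diff pi eps R i.+1 x = left_diff pi eps i.+1 x.
Proof.
move=> hx; rewrite /Kleft_diff (bi_diff_eq pi hR) //; move: x hx.
apply: left_term_min => [|a w hw]; last exact: bi_term_tens.
exact: (subspace_preim (tens_linearl 1) (bi_term_subspace _)).
Qed.

Lemma Kright_diffE i (x : tensor T A) : Kright R i.+1 x ->
  Kright_diff pi eps R i.+1 x = right_diff pi eps i.+1 x.
Proof.
move=> hx; rewrite /Kright_diff (bi_diff_eq pi hR) //; move: x hx.
apply: right_term_min => [|w a hw]; last first.
  by rewrite /= right_to_biE; apply: bi_term_tens.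
exact: (subspace_preim right_to_bi_linear (bi_term_subspace _)).
Qed.

Lemma same_complex_left : same_complex (Kleft R) (Kleft_diff pi eps R)
  (HRleft S R) (HRleft_diff pi S R).
Proof.
have EK i : Kleft (A := A) R i = HRleft S R i by rewrite /Kleft (J_HR_J hR).
split=> // i x hx; rewrite (Kleft_diffE hx); symmetry.
apply: (is_HRleft_diff_unique hR heps); last by rewrite -EK.
apply: (xgetPex (fun=> 0) (P := [set d | is_HRleft_diff pi S R i.+1 d])).
by exists (left_diff pi eps i.+1); apply: left_diff_HR.
Qed.

Lemma same_complex_right : same_complex (Kright R) (Kright_diff pi eps R)
  (HRright S R) (HRright_diff pi S R).
Proof.
have EK i : Kright (A := A) R i = HRright S R i by rewrite /Kright (J_HR_J hR).
split=> // i x hx; rewrite (Kright_diffE hx); symmetry.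
apply: (is_HRright_diff_unique hR heps); last by rewrite -EK.
apply: (xgetPex (fun=> 0) (P := [set d | is_HRright_diff pi S R i.+1 d])).
by exists (right_diff pi eps i.+1); apply: right_diff_HR.
Qed.
End Comparison.

Section Resolutions.
Context {k : fieldType} {M : lmodType k}.
Implicit Types (K : nat -> set M) (d : nat -> M -> M) (aug : M -> k).

Lemma same_complex_sym K d K' d' : same_complex K d K' d' -> same_complex K' d' K d.
Proof. by move=> [EK Ed]; split=> // i x; rewrite -EK => /Ed. Qed.

Lemma same_complex_resolution K d K' d' aug : same_complex K d K' d' ->
  is_resolution K d aug -> is_resolution K' d' aug.
Proof.
move=> [EK Ed] [aug_onto exact0 exactS].
have im i : d' i.+1 @` K' i.+1 = d i.+1 @` K i.+1.
  by rewrite -EK; apply: eq_imagel => x /Ed.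
split; rewrite ?im -?EK // => i; rewrite im exactS -EK.
by apply/seteqP; split=> x /= [Kx dx]; split=> //; rewrite -?Ed // Ed.
Qed.

Lemma same_complex_resolution_iff K d K' d' aug : same_complex K d K' d' ->
  is_resolution K d aug <-> is_resolution K' d' aug.
Proof.
move=> h; split; apply: same_complex_resolution => //; exact: same_complex_sym.
Qed.
End Resolutions.

Theorem proposition3p19 (k : fieldType) (V : vectType k)
    (S : set nat) (R : set (TV V)) (A : algType k)
    (pi : {lrmorphism TV V -> A}) (eps : {lrmorphism A -> k^o})
    (hR : graded_relations S R)
    (hA : is_presentation R pi)
    (heps : is_augmentation pi eps) :
  same_complex (Kleft R) (Kleft_diff pi eps R) (HRleft S R) (HRleft_diff pi S R)
  /\ same_complex (Kright R) (Kright_diff pi eps R)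
       (HRright S R) (HRright_diff pi S R)
  /\ (left_multi_Koszul pi eps R <-> left_multi_Koszul_HR pi eps S R)
  /\ (right_multi_Koszul pi eps R <-> right_multi_Koszul_HR pi eps S R).
Proof.
have hl := same_complex_left hR heps; have hr := same_complex_right hR heps.
split=> //; split=> //; split; exact: same_complex_resolution_iff.
Qed.
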